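(* Suppose every activation function is ReLU, i.e. $\sigma_i(z)=\max\{0,z\}$ for $i=1,\dots,d-1$. Let $\mu,\nu\in\mathcal{P}_{B}$, let $\hat\mu_n,\hat\nu_m$ be their empirical measures, and let $\delta\in(0,1)$. (I) If $\mathcal{F}_{nn}$ is the class of depth-$d$ networks with parameter set $\mathcal{W}_F$, then with probability at least $1-\delta$ over the randomness of $\hat\mu_n$ and $\hat\nu_m$, $$|d_{\mathcal{F}_{nn}}(\mu,\nu)-d_{\mathcal{F}_{nn}}(\hat\mu_n,\hat\nu_m)|\le\sqrt2\,\Gamma_{B}\prod_{i=1}^dM_F(i)\left(2\sqrt{d\log2}+\sqrt{\log(1/\delta)}+\sqrt2\right)\left(n^{-1/2}+m^{-1/2}\right).$$ (II) If $\mathcal{F}_{nn}$ is the class of depth-$d$ networks with parameter set $\mathcal{W}_{1,\infty}$, then with probability at least $1-\delta$ over the randomness of $\hat\mu_n$ and $\hat\nu_m$, $$|d_{\mathcal{F}_{nn}}(\mu,\nu)-d_{\mathcal{F}_{nn}}(\hat\mu_n,\hat\nu_m)|\le\Gamma_{B}\prod_{i=1}^dM_{1,\infty}(i)\left(4\sqrt{d+1+\log h}+\sqrt{2\log(1/\delta)}\right)\left(n^{-1/2}+m^{-1/2}\right).$$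
   Context: Fix integers $h\ge1$ (input dimension), $d\ge2$ (depth), layer widths $k_1=h,k_2,\dots,k_d\ge1$, and sample sizes $n,m\ge1$. For a matrix $\mathbf{W}$, $\|\mathbf{W}\|_F$ is the Frobenius norm and $\|\mathbf{W}\|_{1,\infty}$ is the maximal $\ell_1$ norm of its rows; $\|\cdot\|$ on vectors is the $\ell_2$ norm and $\|\cdot\|_1$ the $\ell_1$ norm. $\log$ is the natural logarithm. Networks: a depth-$d$ neural network is a function of the form $f(\mathbf{x})=\mathbf{w}_d^T\sigma_{d-1}(\mathbf{W}_{d-1}\sigma_{d-2}(\cdots\sigma_1(\mathbf{W}_1\mathbf{x})))$, $\mathbf{x}\in\mathbb{R}^h$, where $\mathbf{W}_i\in\mathbb{R}^{k_{i+1}\times k_i}$ for $i=1,\dots,d-1$, $\mathbf{w}_d\in\mathbb{R}^{k_d}$, and the $\sigma_i$ are applied entrywise. Given positive constants $M_F(i)$, $M_{1,\infty}(i)$, $i=1,\dots,d$, the parameter sets are: $\mathcal{W}_F$, all $(\mathbf{W}_1,\dots,\mathbf{W}_{d-1},\mathbf{w}_d)$ with $\|\mathbf{W}_i\|_F\le M_F(i)$ for $i\le d-1$ and $\|\mathbf{w}_d\|\le M_F(d)$; and $\mathcal{W}_{1,\infty}$, all such tuples with $\|\mathbf{W}_i\|_{1,\infty}\le M_{1,\infty}(i)$ for $i\le d-1$ and $\|\mathbf{w}_d\|_1\le M_{1,\infty}(d)$. $\mathcal{F}_{nn}$ is the set of all such networks with parameters in the given parameter set. Neural net distance: $d_{\mathcal{F}_{nn}}(\mu,\nu)=\sup_{f\in\mathcal{F}_{nn}}|\mathbb{E}_{\mathbf{x}\sim\mu}f(\mathbf{x})-\mathbb{E}_{\mathbf{x}\sim\nu}f(\mathbf{x})|$.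 Class $\mathcal{P}_B$: given $\Gamma_B>0$, $\mathcal{P}_B$ is the set of all Borel probability measures supported in $\{\mathbf{x}\in\mathbb{R}^h:\|\mathbf{x}\|\le\Gamma_B\}$. Empirical measures: $\hat\mu_n$ puts mass $1/n$ on each of $n$ i.i.d. samples from $\mu$, and $\hat\nu_m$ puts mass $1/m$ on each of $m$ i.i.d. samples from $\nu$, the two samples being independent of each other. *)

(* Defs.v *)
From HB Require Import structures.
From mathcomp Require Import all_boot all_order all_algebra.
From mathcomp Require Import all_classical all_reals all_analysis.

Set Implicit Arguments.
Unset Strict Implicit.
Unset Printing Implicit Defensive.

Import Order.TTheory GRing.Theory Num.Theory.
Import numFieldNormedType.Exports.

Local Open Scope classical_set_scope.
Local Open Scope ring_scope.

Section norms.
Context {R : realType}.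

Definition l2norm n (x : 'cV[R]_n) : R := Num.sqrt (\sum_i x i 0 ^+ 2).

Definition l1norm n (x : 'cV[R]_n) : R := \sum_i `|x i 0|.

Definition frobenius_norm m n (W : 'M[R]_(m, n)) : R :=
  Num.sqrt (\sum_i \sum_j W i j ^+ 2).

Definition norm_1_inf m n (W : 'M[R]_(m, n)) : R :=
  \big[Num.max/0]_i \sum_j `|W i j|.

End norms.

(* Layers are numbered from 0: [k i], [W i], [sigma i], [M i] are the objects
   usually written $k_{i+1}$, $W_{i+1}$, $\sigma_{i+1}$, $M(i+1)$. So [k 0] is
   the input dimension, the hidden layers of a network of depth [d] have
   weights [W i] and activations [sigma i] for [i < d.-1], and its output
   weight vector has size [k d.-1] and norm bound [M d.-1]. The entries of the
   nat-indexed families beyond these ranges are never used. *)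
Section networks.
Context {R : realType}.
Implicit Types (k : nat -> nat) (d : nat) (sigma : nat -> R -> R)
  (M : nat -> R).

Definition relu (z : R) : R := Num.max 0 z.

Definition nn_params k d : Type :=
  ((forall i : nat, 'M[R]_(k i.+1, k i)) * 'cV[R]_(k d.-1))%type.

Fixpoint hidden_layer k sigma (W : forall i : nat, 'M[R]_(k i.+1, k i))
    (x : 'cV[R]_(k 0%N)) (l : nat) : 'cV[R]_(k l) :=
  if l is i.+1 then map_mx (sigma i) (W i *m hidden_layer sigma W x i) else x.

Definition network k d sigma (p : nn_params k d) (x : 'cV[R]_(k 0%N)) : R :=
  (p.2^T *m hidden_layer sigma p.1 x d.-1) 0 0.

Definition params_F k d M : set (nn_params k d) :=
  [set p | (forall i, (i < d.-1)%N -> frobenius_norm (p.1 i) <= M i)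
           /\ l2norm p.2 <= M d.-1].

Definition params_1_inf k d M : set (nn_params k d) :=
  [set p | (forall i, (i < d.-1)%N -> norm_1_inf (p.1 i) <= M i)
           /\ l1norm p.2 <= M d.-1].

Definition network_class k d sigma (Theta : set (nn_params k d)) :
    set ('cV[R]_(k 0%N) -> R) :=
  [set network sigma p | p in Theta].

End networks.

(* R^h with its Borel sigma-algebra. *)
Definition borelRn (R : realType) (h : nat) :=
  g_sigma_algebraType (@open 'cV[R]_h).

Section measures.
Context {R : realType} {h : nat}.
Local Open Scope ereal_scope.

Definition bounded_support (Gamma : R) : set (probability (borelRn R h) R) :=
  [set mu : probability (borelRn R h) R |
    mu [set x : 'cV[R]_h | (l2norm x <= Gamma)%R] = 1].

(* The supremum is taken in the extended reals, so that no convention about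
   suprema of unbounded sets is involved. *)
Definition nn_distance (F : set ('cV[R]_h -> R))
    (mu nu : {measure set (borelRn R h) -> \bar R}) : \bar R :=
  ereal_sup [set `| \int[mu]_x (f x)%:E - \int[nu]_x (f x)%:E | | f in F].

End measures.

Section empirical_measure.
Local Open Scope ereal_scope.
Context d (T : measurableType d) (R : realType).
Variables (n : nat) (x : 'I_n -> T).

Definition empirical (A : set T) : \bar R :=
  (n%:R^-1)%:E * \sum_(i < n) \d_(x i) A.

Let empirical0 : empirical set0 = 0.
Proof.
by rewrite /empirical big1 ?mule0// => i _; rewrite measure0.
Qed.

Let empirical_ge0 A : 0 <= empirical A.
Proof. by rewrite mule_ge0// sume_ge0. Qed.

Let empirical_sigma_additive : semi_sigma_additive empirical.
Proof.
pose mx := fun j : nat =>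
  oapp (fun i : 'I_n => (\d_(x i) : {measure set T -> \bar R})) mzero (insub j).
have -> : empirical = mscale ((n%:R^-1)%:nng)%R (msum mx n).
  apply/funext => A; rewrite /empirical /mscale/= /msum/=; congr (_ * _).
  by apply: eq_bigr => i _; rewrite /mx valK.
exact: measure_semi_sigma_additive.
Qed.

HB.instance Definition _ := isMeasure.Build _ _ _ empirical
  empirical0 empirical_ge0 empirical_sigma_additive.

Lemma empirical_setT : (0 < n)%N -> empirical setT = 1.
Proof.
move=> n0; rewrite /empirical.
under eq_bigr do rewrite diracT.
rewrite sumEFin sumr_const card_ord -EFinM mulVf//.
by rewrite pnatr_eq0 -lt0n.
Qed.

End empirical_measure.

Section independence.
Local Open Scope ereal_scope.
Context d d' {Omega : measurableType d} {T : measurableType d'} {R : realType}.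
Variable P : probability Omega R.

(* Taking some of the [B i] to be [setT] gives the product rule for every
   subfamily. *)
Definition mutually_independent (I : finType) (X : I -> {RV P >-> T}) : Prop :=
  forall B : I -> set T, (forall i, measurable (B i)) ->
    P [set w | forall i, B i (X i w)] = \prod_i P (X i @^-1` B i).

Definition pool n m (X : 'I_n -> {RV P >-> T}) (Y : 'I_m -> {RV P >-> T})
    (s : ('I_n + 'I_m)%type) : {RV P >-> T} :=
  match s with inl i => X i | inr j => Y j end.

Definition has_law (X : {RV P >-> T}) (mu : probability T R) : Prop :=
  forall A, measurable A -> distribution P X A = mu A.

Definition holds_with_prob_ge (p : R) (E : set Omega) : Prop :=
  measurable E /\ p%:E <= P E.

End independence.

(* Main.v *)
Require Import Defs.
From HB Require Import structures.
From mathcomp Require Import all_boot all_order all_algebra.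
From mathcomp Require Import all_classical all_reals all_analysis.
From mathcomp Require Import measurable_realfun.
From mathcomp Require Import ring lra.

(* Let D be the distance of the pair (mu, nu) minus that of the empirical pair:
   |D| is at most the supremum over the class of the centred sums
   sum_s c_s (f(X_s) - E f(X_s)), where c_s is 1/n on the first sample and -1/m
   on the second. Since the class is uniformly Lipschitz, the samples may be
   rounded to a finite alphabet; the bound obtained is strictly smaller than the
   claimed one, which pays for the rounding error. For a finite alphabet, the
   exponential moment of the supremum is symmetrised with a ghost sample, and
   the result is controlled by McDiarmid's inequality for random signs alone.
   Symmetrisation costs a factor 2 in the deviation term, which is recovered by
   observing that a ReLU network oscillates on the ball by at most
   Gamma * prod M(i), half of what its sup norm suggests. The mean of the signed
   supremum is bounded by peeling off the layers under an exponential, as in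
   Golowich, Rakhlin and Shamir, "Size-independent sample complexity of neural
   networks". *)

Set Implicit Arguments.
Unset Strict Implicit.
Unset Printing Implicit Defensive.

Import Order.TTheory GRing.Theory Num.Theory.
Import numFieldNormedType.Exports.

Local Open Scope classical_set_scope.
Local Open Scope ring_scope.

(** * Elementary inequalities for the exponential *)

Section exponential.
Context {R : realType}.
Implicit Types x y : R.

Lemma expR_pair x : expR x + expR (- x) <= 2 * expR (x ^+ 2 / 2).
Proof.
pose y := x ^+ 2 / 2.
have y0 : 0 <= y by rewrite /y divr_ge0// sqr_ge0.
pose u : R^nat := series (exp_coeff x) \+ series (exp_coeff (- x)).
have cu : u @ \oo --> expR x + expR (- x).
  by apply: cvgD; exact: is_cvg_series_exp_coeff.
(* Partial sums of even length suffice for the limit, and in them the odd powers of [x] and [- x]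
   cancel. The even terms are compared one by one, since [2 ^ k] times the factorial of [k] is at
   most the factorial of [2 * k]. *)
have c2 : (fun n => u n.*2) @ \oo --> expR x + expR (- x).
  have := cvg_comp _ _ _ cu.
  move=> /(_ _ (fun n => n.*2) \oo).
  apply=> A [N _ HA]; exists N => // n Nn; apply: HA => /=.
  by rewrite (leq_trans Nn)// -addnn leq_addr.
have fact2 k : ((2 ^ k * k`!)%:R : R) <= (k.*2)`!%:R.
  rewrite ler_nat; elim: k => // k IH.
  rewrite doubleS !factS expnS mulnACA; apply: leq_mul; first by rewrite mul2n doubleS.
  by apply: leq_trans IH _; rewrite leq_pmull.
have uE k : u k.*2 <= 2 * series (exp_coeff y) k.
  elim: k => [|k IH]; first by rewrite /u /series/= !big_geq// addr0 mulr0.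
  rewrite doubleS /u /= !seriesSr /exp_coeff /=.
  rewrite mulrDr.
  have -> : (- x) ^+ k.*2.+1 = - x ^+ k.*2.+1.
    by rewrite exprNn -signr_odd/= odd_double/= mulN1r.
  have -> : (- x) ^+ k.*2 = x ^+ k.*2.
    by rewrite exprNn -signr_odd/= odd_double/= mul1r.
  have H : x ^+ k.*2 / (k.*2)`!%:R <= y ^+ k / k`!%:R.
    rewrite /y expr_div_n -exprM -mul2n -mulrA ler_wpM2l//.
      by rewrite mulnC exprM exprn_even_ge0//.
    rewrite -natrX -invfM -natrM lef_pV2 ?posrE ?ltr0n ?fact_gt0//.
      by rewrite mul2n; exact: fact2.
    by rewrite muln_gt0 expn_gt0 fact_gt0.
  move: IH; rewrite /u/= mulNr; lra.
have -> : expR x + expR (- x) = limn (fun n => u n.*2).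
  by apply/esym/cvg_lim.
apply: limr_le; first by apply/cvg_ex; exists (expR x + expR (- x)).
apply: nearW => k; rewrite (le_trans (uE k))// ler_pM2l//.
apply: nondecreasing_cvgn_le; last exact: is_cvg_series_exp_coeff.
apply/nondecreasing_seqP => n; rewrite seriesSr lerDl.
exact: exp_coeff_ge0.
Qed.

Lemma expR_midpoint x y :
  expR x + expR y <= 2 * expR ((x + y) / 2 + ((x - y) / 2) ^+ 2 / 2).
Proof.
have := expR_pair ((x - y) / 2).
rewrite -(ler_pM2l (expR_gt0 ((x + y) / 2))) mulrDr mulrCA -!expRD.
suff -> : (x + y) / 2 + (x - y) / 2 = x by suff -> : (x + y) / 2 - (x - y) / 2 = y by []; lra.
lra.
Qed.

Lemma expR_abs x : expR `|x| <= expR x + expR (- x).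
Proof.
by case: (ger0P x) => _; rewrite ?lerDl ?lerDr expR_ge0.
Qed.

(** The tangent of the exponential at the weighted mean [m] lies below the graph, and its own
    weighted average is [expR m]. *)
Lemma expR_jensen (J : finType) (w g : J -> R) :
    (forall j, 0 <= w j) -> \sum_j w j = 1 ->
  expR (\sum_j w j * g j) <= \sum_j w j * expR (g j).
Proof.
move=> w0 w1; pose m := \sum_j w j * g j; rewrite -/m.
apply: (@le_trans _ _ (\sum_j w j * (expR m * (1 + (g j - m))))).
  have -> : \sum_j w j * (expR m * (1 + (g j - m))) =
      expR m * ((1 - m) * \sum_j w j + m).
    by rewrite /m mulrDr !mulr_sumr -big_split/=; apply: eq_bigr => j _; ring.
  by rewrite w1 mulr1 subrK mulr1.
apply: ler_sum => j _; rewrite ler_wpM2l//.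
have {2}-> : g j = m + (g j - m) by lra.
by rewrite expRD ler_pM2l ?expR_gt0//; exact: expR_ge1Dx.
Qed.

(* The maximum is over the two ways of assigning the points to the two signs;
   at two nonpositive points the bound holds for the average of both ways. *)
Lemma relu_pair a b k x y :
  expR (a + k * relu x) + expR (b - k * relu y) <=
  Num.max (expR (a + k * x) + expR (b - k * y))
          (expR (a - k * x) + expR (b + k * y)).
Proof.
rewrite le_max /relu.
have mono (u v w z : R) : u <= w -> v <= z -> expR u + expR v <= expR w + expR z.
  by move=> *; rewrite lerD// ler_expR.
case: (leP 0 x) => x0; case: (leP 0 y) => y0; rewrite ?mulr0 ?subr0 ?addr0.
- by rewrite lexx.
- case: (leP 0 k) => k0; apply/orP; [left|right]; apply: mono => //; nra.
- case: (leP 0 k) => k0; apply/orP; [right|left]; apply: mono => //; nra.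
- have H (c z : R) : expR c <= (expR (c + z) + expR (c - z)) / 2.
    rewrite !expRD.
    have e0 := expR_gt0 c; have := expR_gt0 z.
    have : expR z * expR (- z) = 1 by rewrite -expRD subrr expR0.
    move: (expR z) (expR (- z)) => p q pq p0.
    have := sqr_ge0 (p - 1); nra.
  have := H a (k * x); have := H b (k * y).
  case: (leP (expR a + expR b) (expR (a + k * x) + expR (b - k * y))) => //= h.
  by move: h; lra.
Qed.

End exponential.

(** * Averages over sign vectors *)

Section sign_vectors.
Context {R : realType} {I : finType}.
Implicit Types (e : {ffun I -> bool}) (g : {ffun I -> bool} -> R) (s u : I).

Definition sgn e s : R := (-1) ^+ e s.

Definition flip s e : {ffun I -> bool} := [ffun u => (u == s) (+) e u].

Definition neg e : {ffun I -> bool} := [ffun u => ~~ e u].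

Definition mean g : R := #|{ffun I -> bool}|%:R^-1 * \sum_e g e.

Lemma sgn_sqr e s : sgn e s * sgn e s = 1.
Proof. by rewrite -expr2 sqrr_sign. Qed.

Lemma normr_sgn e s : `|sgn e s| = 1.
Proof. exact: normr_sign. Qed.

Lemma sgn_flip e s : sgn (flip s e) s = - sgn e s.
Proof. by rewrite /sgn ffunE eqxx/=; case: (e s); rewrite ?expr0 ?expr1 ?opprK. Qed.

Lemma sgn_flip_neq e s u : u != s -> sgn (flip s e) u = sgn e u.
Proof. by rewrite /sgn ffunE => /negbTE ->. Qed.

Lemma sgn_neg e s : sgn (neg e) s = - sgn e s.
Proof. by rewrite /sgn ffunE; case: (e s); rewrite ?expr0 ?expr1 ?opprK. Qed.

Lemma flipK s : involutive (flip s).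
Proof. by move=> e; apply/ffunP => u; rewrite !ffunE addbA addbb. Qed.

Lemma flipC s u e : flip s (flip u e) = flip u (flip s e).
Proof. by apply/ffunP => v; rewrite !ffunE addbCA. Qed.

Lemma negK : involutive neg.
Proof. by move=> e; apply/ffunP => u; rewrite !ffunE negbK. Qed.

Let card_gt0 : 0 < #|{ffun I -> bool}|%:R :> R.
Proof. by rewrite ltr0n; apply/card_gt0P; exists [ffun => true]. Qed.

Lemma mean_le g1 g2 : (forall e, g1 e <= g2 e) -> mean g1 <= mean g2.
Proof. by move=> H; rewrite ler_pM2l ?invr_gt0//; apply: ler_sum. Qed.

Lemma eq_mean g1 g2 : g1 =1 g2 -> mean g1 = mean g2.
Proof. by move=> H; congr (_ * _); apply: eq_bigr. Qed.

Lemma meanD g1 g2 : mean (fun e => g1 e + g2 e) = mean g1 + mean g2.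
Proof. by rewrite /mean big_split mulrDr. Qed.

Lemma meanZ (a : R) g : mean (fun e => a * g e) = a * mean g.
Proof. by rewrite /mean -mulr_sumr mulrCA. Qed.

Lemma mean_cst (a : R) : mean (fun=> a) = a.
Proof. by rewrite /mean sumr_const -[a *+ _]mulr_natl mulKf// gt_eqF. Qed.

Lemma meanN g : mean (fun e => - g e) = - mean g.
Proof. by rewrite /mean sumrN mulrN. Qed.

Lemma mean_sum (J : Type) (r : seq J) (Q : pred J) (f : J -> {ffun I -> bool} -> R) :
  mean (fun e => \sum_(j <- r | Q j) f j e) = \sum_(j <- r | Q j) mean (f j).
Proof. by rewrite /mean exchange_big mulr_sumr. Qed.

Lemma mean_ge0 g : (forall e, 0 <= g e) -> 0 <= mean g.
Proof. by move=> H; rewrite -(mean_cst 0); apply: mean_le. Qed.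

Lemma mean_flip s g : mean (fun e => g (flip s e)) = mean g.
Proof. by congr (_ * _); rewrite [RHS](reindex_inj (inv_inj (flipK s))). Qed.

Lemma mean_neg g : mean (fun e => g (neg e)) = mean g.
Proof. by congr (_ * _); rewrite [RHS](reindex_inj (inv_inj negK)). Qed.

(** Hoeffding's lemma and the ReLU contraction fail at a single sign vector and hold only jointly
    for the two ends of an edge of the cube; this sums such comparisons over all edges in direction
    [s]. *)
Lemma mean_pair s g1 g2 :
    (forall e, g1 e + g1 (flip s e) <= g2 e + g2 (flip s e)) ->
  mean g1 <= mean g2.
Proof.
move=> H; have := mean_le H; rewrite !meanD !mean_flip; lra.
Qed.

Lemma mean_sgn s : mean (fun e => sgn e s) = 0.
Proof.
suff : mean (fun e => sgn e s) = - mean (fun e => sgn e s) by lra.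
by rewrite -[LHS](mean_flip s) -meanN; apply: eq_mean => e; rewrite sgn_flip.
Qed.

Lemma mean_sgnM s u : mean (fun e => sgn e s * sgn e u) = (s == u)%:R.
Proof.
case: eqVneq => [->|su].
  by under eq_mean do rewrite sgn_sqr; rewrite mean_cst.
suff : mean (fun e => sgn e s * sgn e u) = - mean (fun e => sgn e s * sgn e u).
  by rewrite /=; lra.
rewrite -[LHS](mean_flip s) -meanN; apply: eq_mean => e.
by rewrite sgn_flip sgn_flip_neq 1?eq_sym// mulNr.
Qed.

Lemma mean_sqr_sgn_sum (y : I -> R) :
  mean (fun e => (\sum_s sgn e s * y s) ^+ 2) = \sum_s y s ^+ 2.
Proof.
under eq_mean do rewrite expr2 big_distrlr/=.
rewrite mean_sum; apply: eq_bigr => s _; rewrite mean_sum (bigD1 s)//= big1.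
  rewrite addr0; under eq_mean do rewrite mulrACA.
  have -> : mean (fun e => sgn e s * sgn e s * (y s * y s)) =
            mean (fun e => (y s * y s) * (sgn e s * sgn e s)).
    by apply: eq_mean => e; rewrite mulrC.
  by rewrite meanZ mean_sgnM eqxx mulr1 expr2.
move=> u us.
have -> : mean (fun e => sgn e s * y s * (sgn e u * y u)) =
          mean (fun e => (y s * y u) * (sgn e s * sgn e u)).
  by apply: eq_mean => e; rewrite mulrACA mulrC.
by rewrite meanZ mean_sgnM eq_sym (negbTE us) mulr0.
Qed.

Lemma mean_sgn_sum (y : I -> R) : mean (fun e => \sum_s sgn e s * y s) = 0.
Proof.
rewrite mean_sum big1// => s _.
by under eq_mean do rewrite mulrC; rewrite meanZ mean_sgn mulr0.
Qed.

Lemma sqr_mean_le g : (mean g) ^+ 2 <= mean (fun e => g e ^+ 2).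
Proof.
have : 0 <= mean (fun e => (g e - mean g) ^+ 2).
  by apply: mean_ge0 => e; exact: sqr_ge0.
have -> : mean (fun e => (g e - mean g) ^+ 2) =
          mean (fun e => g e ^+ 2 + ((- (2 * mean g)) * g e + (mean g) ^+ 2)).
  by apply: eq_mean => e; ring.
by rewrite !meanD meanZ mean_cst; lra.
Qed.

Lemma expR_mean_le g : expR (mean g) <= mean (fun e => expR (g e)).
Proof.
rewrite /mean !mulr_sumr; apply: expR_jensen => [e|]; first by rewrite invr_ge0 ltW.
by rewrite sumr_const -[_ *+ _]mulr_natl mulfV// gt_eqF.
Qed.

(** A path of flips joins [e] to [e'], flipping only signs in [r] where they differ. It makes a
    function invariant under all flips constant, the base case of McDiarmid's inequality. *)
Lemma flip_invariant_eq (S : {ffun I -> bool} -> R) (r : seq I) e e' :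
    (forall s, s \in r -> forall e, S (flip s e) = S e) ->
    (forall u, u \notin r -> e u = e' u) -> S e = S e'.
Proof.
elim: r e => [|s r IH] e HS He.
  by congr S; apply/ffunP => u; exact: He.
have IH' := IH _ (fun s' sr => HS s' (@mem_behead _ (s :: r) s' sr)).
have [es|es] := eqVneq (e s) (e' s).
  apply: IH' => u ur; have [->//|us] := eqVneq u s.
  by apply: He; rewrite inE negb_or us.
rewrite -(HS s (mem_head _ _)); apply: IH' => u ur; rewrite ffunE.
have [->|us] /= := eqVneq u s; first by move: es; case: (e s); case: (e' s).
by apply: He; rewrite inE negb_or us.
Qed.

(* Hoeffding's lemma on one sign at a time. *)
Lemma cube_mcdiarmid (S : {ffun I -> bool} -> R) (c : I -> R) :
    (forall s e, `|S e - S (flip s e)| <= 2 * c s) ->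
  mean (fun e => expR (S e)) <= expR (mean S + (\sum_s c s ^+ 2) / 2).
Proof.
(* Induction on a list [r] outside which the function is insensitive to flips; for the empty list it
   is constant and both sides agree. *)
suff H (r : seq I) (S0 : {ffun I -> bool} -> R) : uniq r ->
    (forall s e, s \in r -> `|S0 e - S0 (flip s e)| <= 2 * c s) ->
    (forall s, s \notin r -> forall e, S0 (flip s e) = S0 e) ->
    mean (fun e => expR (S0 e)) <= expR (mean S0 + (\sum_(s <- r) c s ^+ 2) / 2).
  move=> HS; have := H (index_enum I) S (index_enum_uniq _).
  apply=> [s e _|s]; [exact: HS|by rewrite mem_index_enum].
elim: r S0 => [|s r IH] S0.
  move=> _ _ HS; rewrite big_nil mul0r addr0.
  have E e : S0 e = S0 [ffun => true].
    apply: (@flip_invariant_eq S0 (index_enum I)) => // u.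
      by move=> _; exact: HS.
    by rewrite mem_index_enum.
  under eq_mean do rewrite E; rewrite (eq_mean E) !mean_cst.
  exact: lexx.
move=> /= /andP[sr ur] HS Hinv.
(* Averaging out the sign [s] preserves the mean and the increment bounds of the other signs;
   Hoeffding's lemma charges [c s ^+ 2 / 2] for it. *)
pose S1 e := (S0 e + S0 (flip s e)) / 2.
have mS1 : mean S1 = mean S0.
  rewrite (eq_mean (_ : S1 =1 (fun e => 2^-1 * (S0 e + S0 (flip s e))))); last first.
    by move=> e; rewrite mulrC.
  by rewrite meanZ meanD mean_flip; lra.
have K : mean (fun e => expR (S0 e)) <=
    mean (fun e => expR (c s ^+ 2 / 2) * expR (S1 e)).
  apply: (@mean_pair s) => e; rewrite -!expRD.
  have -> : S1 (flip s e) = S1 e by rewrite /S1 flipK addrC.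
  apply: le_trans (expR_midpoint _ _) _.
  rewrite [leRHS](_ : _ = 2 * expR (c s ^+ 2 / 2 + S1 e)); last by lra.
  rewrite ler_pM2l// ler_expR addrC lerD2r ler_pM2r// -ler_sqrt ?sqr_ge0//.
  rewrite !sqrtr_sqr normrM [ `|2^-1|]ger0_norm//.
  have := HS s e (mem_head _ _); have := ler_norm (c s).
  by lra.
apply: le_trans K _; rewrite meanZ big_cons mulrDl addrCA expRD ler_pM2l ?expR_gt0//.
rewrite -mS1; apply: IH => //.
  move=> u e ur'; have su : u \in s :: r by rewrite inE ur' orbT.
  have := HS u e su; have := HS u (flip s e) su.
  rewrite /S1 (flipC s u) => h1 h2.
  rewrite (_ : _ - _ = ((S0 e - S0 (flip u e)) +
    (S0 (flip s e) - S0 (flip u (flip s e)))) / 2); last lra.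
  rewrite normrM [ `|2^-1|]ger0_norm//.
  have := ler_normD (S0 e - S0 (flip u e)) (S0 (flip s e) - S0 (flip u (flip s e))).
  lra.
move=> u ur' e; have [->|us] := eqVneq u s.
  by rewrite /S1 flipK addrC.
have Hu : u \notin s :: r by rewrite inE negb_or us.
by rewrite /S1 (flipC s u) !(Hinv u Hu).
Qed.

Lemma mean_expR_sgn_sum (y : I -> R) :
  mean (fun e => expR (\sum_s sgn e s * y s)) <= expR ((\sum_s y s ^+ 2) / 2).
Proof.
rewrite -[X in expR X]add0r -[X in X + _](mean_sgn_sum y).
under [X in expR (_ + X / _)]eq_bigr do rewrite -real_normK ?num_real//.
apply: cube_mcdiarmid => s e.
rewrite (bigD1 s)//= [X in _ - X](bigD1 s)//= sgn_flip.
under [X in _ - (_ + X)]eq_bigr do rewrite sgn_flip_neq//.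
rewrite (_ : _ - _ = 2 * (sgn e s * y s)); last by lra.
by rewrite !normrM normr_sgn mul1r ger0_norm.
Qed.

Lemma mean_expR_norm_sgn_sum (y : I -> R) :
  mean (fun e => expR `|\sum_s sgn e s * y s|) <= 2 * expR ((\sum_s y s ^+ 2) / 2).
Proof.
apply: le_trans (mean_le (fun e => expR_abs _)) _; rewrite meanD.
have := mean_expR_sgn_sum y.
have := mean_expR_sgn_sum (fun s => - y s).
under eq_bigr do rewrite sqrrN.
under eq_mean do (under eq_bigr do rewrite mulrN; rewrite sumrN).
lra.
Qed.

(* The family is indexed by an arbitrary type and the supremum over it is
   replaced by an arbitrary choice of index [t e] for each sign vector [e]. *)
Lemma relu_contraction (X : Type) (Q : X -> Prop) (v : X -> I -> R) (c : I -> R)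
    (t : {ffun I -> bool} -> X) : (forall e, Q (t e)) ->
  exists2 t' : {ffun I -> bool} -> X, (forall e, Q (t' e)) &
    mean (fun e => expR (\sum_s sgn e s * (c s * relu (v (t e) s)))) <=
    mean (fun e => expR (\sum_s sgn e s * (c s * v (t' e) s))).
Proof.
move=> Qt.
(* The ReLUs are removed one sign at a time; [r] lists those already gone. *)
pose phi (r : seq I) x s := if s \in r then v x s else relu (v x s).
suff H (r : seq I) : exists2 t' : {ffun I -> bool} -> X, (forall e, Q (t' e)) &
    mean (fun e => expR (\sum_s sgn e s * (c s * relu (v (t e) s)))) <=
    mean (fun e => expR (\sum_s sgn e s * (c s * phi r (t' e) s))).
  have [t' Qt' Ht'] := H (index_enum I); exists t' => //.
  apply: le_trans Ht' _; apply: mean_le => e; rewrite ler_expR.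
  by apply: ler_sum => s _; rewrite /phi mem_index_enum.
elim: r => [|s r [t1 Qt1 Ht1]]; first by exists t => //; apply: mean_le => e.
have [sr|sr] := boolP (s \in r).
  exists t1 => //; apply: le_trans Ht1 _; apply: mean_le => e; rewrite ler_expR.
  apply: ler_sum => u _; rewrite /phi inE.
  by case: eqVneq => [->|//]; rewrite sr.
pose k e := sgn e s * c s.
pose rest e x := \sum_(u | u != s) sgn e u * (c u * phi r x u).
pose G e x := expR (rest e x + k e * v x s).
pose keep e := G e (t1 e) + G (flip s e) (t1 (flip s e)).
pose swap e := G e (t1 (flip s e)) + G (flip s e) (t1 e).
(* The vectors [e] and [flip s e] keep or exchange their indices, whichever gives the larger joint
   value; this realises the maximum in [relu_pair]. Both make the same decision because [keep] and
   [swap] are invariant under the flip. *)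
pose t2 e := if swap e <= keep e then t1 e else t1 (flip s e).
exists t2; first by move=> e; rewrite /t2; case: ifP.
apply: le_trans Ht1 _; apply: (@mean_pair s) => e.
have restE e' x : rest (flip s e') x = rest e' x.
  by apply: eq_bigr => u us; rewrite sgn_flip_neq.
have kE e' : k (flip s e') = - k e' by rewrite /k sgn_flip mulNr.
have lhsE e' x : \sum_u sgn e' u * (c u * phi r x u) = rest e' x + k e' * relu (v x s).
  by rewrite (bigD1 s)//= addrC /phi (negbTE sr) mulrA.
have rhsE e' x : \sum_u sgn e' u * (c u * phi (s :: r) x u) = rest e' x + k e' * v x s.
  rewrite (bigD1 s)//= addrC /phi mem_head mulrA; congr (_ + _).
  by apply: eq_bigr => u us; rewrite inE (negbTE us).
rewrite !lhsE !rhsE -/(G _ _) -/(G _ _).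
have keepE : keep (flip s e) = keep e by rewrite /keep flipK addrC.
have swapE : swap (flip s e) = swap e by rewrite /swap flipK addrC.
rewrite /t2 keepE swapE flipK.
have := relu_pair (rest e (t1 e)) (rest e (t1 (flip s e))) (k e)
  (v (t1 e) s) (v (t1 (flip s e)) s).
rewrite restE kE mulNr => h; apply: le_trans h _.
rewrite ge_max; rewrite /keep /swap /G !restE !kE !mulNr.
case: ifPn => [h|]; first by rewrite lexx/= (le_trans _ h)// addrC.
by rewrite -ltNge => /ltW h; rewrite (le_trans h)//= addrC.
Qed.

(** The exponential of an absolute value is at most the sum over both signs, and the negative half
    becomes a positive one when all signs are negated. Each half is contracted separately and the
    better selection serves for both, whence the factor 2. *)
Lemma relu_contraction_norm (X : Type) (Q : X -> Prop) (v : X -> I -> R)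
    (c : I -> R) (t : {ffun I -> bool} -> X) : (forall e, Q (t e)) ->
  exists2 t' : {ffun I -> bool} -> X, (forall e, Q (t' e)) &
    mean (fun e => expR `|\sum_s sgn e s * (c s * relu (v (t e) s))|) <=
    2 * mean (fun e => expR (\sum_s sgn e s * (c s * v (t' e) s))).
Proof.
move=> Qt.
pose Z e x := \sum_s sgn e s * (c s * relu (v x s)).
have ZN e x : Z (neg e) x = - Z e x.
  by rewrite /Z -sumrN; apply: eq_bigr => s _; rewrite sgn_neg mulNr.
have H : mean (fun e => expR `|Z e (t e)|) <=
    mean (fun e => expR (Z e (t e))) + mean (fun e => expR (Z e (t (neg e)))).
  rewrite -[X in _ <= _ + X]mean_neg -meanD; apply: mean_le => e.
  by rewrite negK ZN; exact: expR_abs.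
have [t1 Qt1 Ht1] := relu_contraction v c Qt.
have [t2 Qt2 Ht2] := relu_contraction v c (fun e => Qt (neg e)).
rewrite -/(Z _ _) in Ht1 *.
have [h|/ltW h] := leP (mean (fun e => expR (\sum_s sgn e s * (c s * v (t1 e) s))))
  (mean (fun e => expR (\sum_s sgn e s * (c s * v (t2 e) s)))).
  exists t2 => //; move: H Ht1 Ht2 h; rewrite /Z; lra.
exists t1 => //; move: H Ht1 Ht2 h; rewrite /Z; lra.
Qed.

(** By Jensen's inequality the mean is at most [b + a / l + l * v / 2], which is minimal at
    [l = sqrt (2 * a / v)], written [w / v] below. *)
Lemma mean_le_of_expR (Z : {ffun I -> bool} -> R) (a b v : R) : 0 < a -> 0 < v ->
    (forall l, 0 < l -> mean (fun e => expR (l * Z e)) <=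
                        expR (a + l * b + l ^+ 2 * v / 2)) ->
  mean Z <= b + Num.sqrt (2 * a * v).
Proof.
move=> a0 v0 H; pose w := Num.sqrt (2 * a * v).
have w2 : w ^+ 2 = 2 * a * v by rewrite sqr_sqrtr//; nra.
have w0 : 0 < w by rewrite sqrtr_gt0; nra.
have l0 : 0 < w / v by rewrite divr_gt0.
have := le_trans (expR_mean_le _) (H _ l0).
rewrite ler_expR meanZ => h.
rewrite -(ler_pM2l l0) (le_trans h)// -/w.
have -> : (w / v) ^+ 2 * v / 2 = w ^+ 2 / v / 2 by field; rewrite gt_eqF.
have -> : w / v * (b + w) = w / v * b + w ^+ 2 / v by field; rewrite gt_eqF.
by rewrite w2 mulfK ?gt_eqF//; lra.
Qed.

End sign_vectors.

(** * Networks and peeling *)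

(* [vnorm] measures layer outputs, [dnorm] weight vectors and [mnorm] weight
   matrices: (l2, l2, Frobenius) for part (I), (linf, l1, (1,inf)) for (II). *)
Record layer_norms (R : realType) := LayerNorms {
  vnorm : forall n, 'cV[R]_n -> R;
  dnorm : forall n, 'cV[R]_n -> R;
  mnorm : forall m n, 'M[R]_(m, n) -> R;
  vnorm_ge0 : forall n (x : 'cV[R]_n), 0 <= vnorm x;
  dnormN : forall n (w : 'cV[R]_n), dnorm (- w) = dnorm w;
  vnorm_hoelder : forall n (w x : 'cV[R]_n),
    `|(w^T *m x) 0 0| <= dnorm w * vnorm x;
  vnorm_dominated : forall m n (W : 'M[R]_(m, n)) (y : 'cV[R]_m) (b : R),
    0 <= b ->
    (forall j, exists2 z, vnorm z <= b & `|y j 0| <= `|(W *m z) j 0|) ->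
    vnorm y <= mnorm W * b;
  neuron_selection : forall m n (W : 'M[R]_(m, n)) (M : R) (I : finType)
      (c : I -> R) (z : I -> 'cV[R]_n), mnorm W <= M -> 0 <= M ->
    exists2 u : 'cV[R]_n, dnorm u <= M &
      vnorm (\sum_s c s *: map_mx relu (W *m z s)) <=
      `|\sum_s c s * relu ((u^T *m z s) 0 0)|;
  vnorm_le_l1 : forall n (x : 'cV[R]_n), vnorm x <= l1norm x;
  vnorm_le_l2 : forall n (x : 'cV[R]_n), vnorm x <= l2norm x
}.

Section relu.
Context {R : realType}.
Implicit Types x y a : R.

Lemma relu0 : relu (0 : R) = 0.
Proof. by rewrite /relu maxxx. Qed.

Lemma reluZ a x : 0 <= a -> relu (a * x) = a * relu x.
Proof. by move=> a0; rewrite /relu maxr_pMr// mulr0. Qed.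

Lemma norm_relu_le x : `|relu x| <= `|x|.
Proof. by rewrite /relu maxElt; case: ltP => x0; rewrite ?normr0. Qed.

Lemma norm_reluB_le x y : `|relu x - relu y| <= `|x - y|.
Proof.
rewrite /relu !maxElt; case: ltP => x0; case: ltP => y0; rewrite ?subr0 ?sub0r ?normrN ?normr0//.
- by rewrite (gtr0_norm x0) ler_normr; apply/orP; left; lra.
- by rewrite (gtr0_norm y0) ler_normr; apply/orP; right; lra.
Qed.

Lemma norm_reluB_max x y : `|relu x - relu y| <= `|x| \/ `|relu x - relu y| <= `|y|.
Proof.
rewrite /relu !maxElt; case: ltP => x0; case: ltP => y0;
  rewrite ?subr0 ?sub0r ?normrN ?normr0; [|by left|by right|by left].
rewrite (gtr0_norm x0) (gtr0_norm y0) !ler_norml.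
by case: (leP x y) => xy; [right|left]; lra.
Qed.

End relu.

Section networks.
Context {R : realType} (N : layer_norms R) (k : nat -> nat) (sigma : nat -> R -> R)
  (M : nat -> R).
Implicit Types (W : forall i : nat, 'M[R]_(k i.+1, k i)) (x : 'cV[R]_(k 0%N)).

Lemma hidden_layer_norm l W x :
    (forall i, (i < l)%N -> sigma i = relu) -> (forall i, (i < l)%N -> 0 < M i) ->
    (forall i, (i < l)%N -> mnorm N (W i) <= M i) ->
  vnorm N (hidden_layer sigma W x l) <= (\prod_(i < l) M i) * vnorm N x.
Proof.
elim: l => [|l IH] Hs M0 HW; first by rewrite big_ord0 mul1r.
have P0 : 0 <= \prod_(i < l) M i.
  by apply: prodr_ge0 => i _; apply/ltW/M0/ltnW; rewrite ltnS.
have b0 : 0 <= (\prod_(i < l) M i) * vnorm N x by rewrite mulr_ge0// vnorm_ge0.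
rewrite big_ord_recr/= mulrAC [leRHS]mulrC.
apply: (@le_trans _ _ (mnorm N (W l) * ((\prod_(i < l) M i) * vnorm N x))); last first.
  by rewrite ler_wpM2r// HW.
apply: vnorm_dominated => // j; exists (hidden_layer sigma W x l).
  by apply: IH => i il; [apply: Hs|apply: M0|apply: HW]; exact: ltnW.
by rewrite mxE Hs// norm_relu_le.
Qed.

Lemma hidden_layer_lipschitz l W x y :
    (forall i, (i < l)%N -> sigma i = relu) -> (forall i, (i < l)%N -> 0 < M i) ->
    (forall i, (i < l)%N -> mnorm N (W i) <= M i) ->
  vnorm N (hidden_layer sigma W x l - hidden_layer sigma W y l) <=
  (\prod_(i < l) M i) * vnorm N (x - y).
Proof.
elim: l => [|l IH] Hs M0 HW; first by rewrite big_ord0 mul1r.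
have P0 : 0 <= \prod_(i < l) M i.
  by apply: prodr_ge0 => i _; apply/ltW/M0/ltnW; rewrite ltnS.
have b0 : 0 <= (\prod_(i < l) M i) * vnorm N (x - y) by rewrite mulr_ge0// vnorm_ge0.
rewrite big_ord_recr/= mulrAC [leRHS]mulrC.
apply: (@le_trans _ _ (mnorm N (W l) * ((\prod_(i < l) M i) * vnorm N (x - y)))); last first.
  by rewrite ler_wpM2r// HW.
apply: vnorm_dominated => // j; exists (hidden_layer sigma W x l - hidden_layer sigma W y l).
  by apply: IH => i il; [apply: Hs|apply: M0|apply: HW]; exact: ltnW.
by rewrite mulmxBr !mxE Hs// norm_reluB_le.
Qed.

(* ReLU outputs are nonnegative, so entrywise the difference of two of them is
   at most one of the two pre-activations: there is no factor 2. *)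
Lemma hidden_layer_oscillation l W x y (G : R) :
    (forall i, (i <= l)%N -> sigma i = relu) -> (forall i, (i <= l)%N -> 0 < M i) ->
    (forall i, (i <= l)%N -> mnorm N (W i) <= M i) ->
    0 <= G -> vnorm N x <= G -> vnorm N y <= G ->
  vnorm N (hidden_layer sigma W x l.+1 - hidden_layer sigma W y l.+1) <=
  (\prod_(i < l.+1) M i) * G.
Proof.
move=> Hs M0 HW G0 xG yG.
have P0 : 0 <= \prod_(i < l) M i.
  by apply: prodr_ge0 => i _; apply/ltW/M0/ltnW.
have b0 : 0 <= (\prod_(i < l) M i) * G by rewrite mulr_ge0.
rewrite big_ord_recr/= mulrAC [leRHS]mulrC.
apply: (@le_trans _ _ (mnorm N (W l) * ((\prod_(i < l) M i) * G))); last first.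
  by rewrite ler_wpM2r// HW.
have hz z : vnorm N z <= G -> vnorm N (hidden_layer sigma W z l) <= (\prod_(i < l) M i) * G.
  move=> zG; apply: le_trans (hidden_layer_norm _ _ _ _) _ => [i il|i il|i il|];
    [exact/Hs/ltnW|exact/M0/ltnW|exact/HW/ltnW|by rewrite ler_wpM2l].
apply: vnorm_dominated => // j; rewrite !mxE Hs//.
(* Some rows are dominated through [x] and others through [y]; for this reason [vnorm_dominated]
   lets the vector [z] depend on the row. *)
have [h|h] := norm_reluB_max ((W l *m hidden_layer sigma W x l) j 0)
  ((W l *m hidden_layer sigma W y l) j 0).
- by exists (hidden_layer sigma W x l); [exact: hz|move: h; rewrite !mxE].
- by exists (hidden_layer sigma W y l); [exact: hz|move: h; rewrite !mxE].
Qed.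

Context {I : finType} (c : I -> R) (x : I -> 'cV[R]_(k 0%N)).

(** The norm of the top layer is dominated by the absolute value of a single neuron, chosen for each
    sign vector. Contraction strips its ReLU at the cost of a factor 2, and Hoelder's inequality
    trades the neuron for [M l] times the norm of the layer below. The lower matrices change with
    the new selection, hence a statement for every family [W]. *)
Lemma peeling l (W : {ffun I -> bool} -> forall i : nat, 'M[R]_(k i.+1, k i)) (a : R) :
    (forall i, (i < l)%N -> sigma i = relu) -> (forall i, (i < l)%N -> 0 < M i) ->
    (forall e i, (i < l)%N -> mnorm N (W e i) <= M i) -> 0 <= a ->
  mean (fun e => expR (a * vnorm N (\sum_s (sgn e s * c s) *: hidden_layer sigma (W e) (x s) l)))
  <= 2 ^+ l * mean (fun e => expR (a * (\prod_(i < l) M i) *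
                      vnorm N (\sum_s (sgn e s * c s) *: x s))).
Proof.
elim: l W a => [|l IH] W a Hs M0 HW a0.
  by rewrite expr0 mul1r big_ord0; apply: mean_le => e; rewrite mulr1.
have Ml0 : 0 <= M l by exact/ltW/M0.
have sel e : exists u : 'cV[R]_(k l), dnorm N u <= M l /\
    vnorm N (\sum_s (sgn e s * c s) *: hidden_layer sigma (W e) (x s) l.+1) <=
    `|\sum_s (sgn e s * c s) * relu ((u^T *m hidden_layer sigma (W e) (x s) l) 0 0)|.
  have [u u1 u2] := neuron_selection (fun s => sgn e s * c s)
    (fun s => hidden_layer sigma (W e) (x s) l) (HW e l (ltnSn l)) Ml0.
  by exists u; split => //=; rewrite Hs.
have {sel}[u Hu] := choice sel.
pose X := ((forall i : nat, 'M[R]_(k i.+1, k i)) * 'cV[R]_(k l))%type.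
pose Q (p : X) := (forall i, (i < l)%N -> mnorm N (p.1 i) <= M i) /\ dnorm N p.2 <= M l.
(* The nonnegative scale [a] moves inside the ReLU by homogeneity. *)
pose v (p : X) s := a * (p.2^T *m hidden_layer sigma p.1 (x s) l) 0 0.
pose t e : X := (W e, u e).
have Qt e : Q (t e) by split=> [i il|]; [apply/HW/ltnW|case: (Hu e)].
have [t' Qt' Ht'] := relu_contraction_norm v c Qt.
apply: (@le_trans _ _ (2 * mean (fun e => expR (\sum_s sgn e s * (c s * v (t' e) s))))).
  apply: le_trans Ht'; apply: mean_le => e; rewrite ler_expR.
  have [_ h] := Hu e; apply: le_trans (ler_wpM2l a0 h) _.
  rewrite -{1}(ger0_norm a0) -normrM mulr_sumr le_eqVlt; apply/orP; left; apply/eqP.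
  congr (`| _ |); apply: eq_bigr => s _.
  by rewrite /v reluZ//=; ring.
rewrite exprS -mulrA ler_pM2l//.
pose P := \prod_(i < l) M i.
apply: (@le_trans _ _ (mean (fun e => expR ((a * M l) * vnorm N
    (\sum_s (sgn e s * c s) *: hidden_layer sigma (t' e).1 (x s) l))))).
  apply: mean_le => e; rewrite ler_expR.
  have -> : \sum_s sgn e s * (c s * v (t' e) s) = a * ((t' e).2^T *m
      (\sum_s (sgn e s * c s) *: hidden_layer sigma (t' e).1 (x s) l)) 0 0.
    rewrite mulmx_sumr summxE mulr_sumr; apply: eq_bigr => s _.
    by rewrite -scalemxAr [X in a * X]mxE /v; ring.
  rewrite -mulrA ler_wpM2l// (le_trans (ler_norm _))//.
  apply: le_trans (vnorm_hoelder N _ _) _.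
  by apply: ler_wpM2r; [exact: vnorm_ge0|case: (Qt' e)].
apply: le_trans (IH _ _ _ _ _ _) _ => [i il|i il|e i il||].
- exact/Hs/ltnW.
- exact/M0/ltnW.
- by have [h _] := Qt' e; exact: h.
- by rewrite mulr_ge0.
rewrite ler_pM2l ?exprn_gt0//; apply: mean_le => e.
have -> : \prod_(i < l.+1) M i = M l * \prod_(i < l) M i by rewrite big_ord_recr/= mulrC.
by rewrite mulrA.
Qed.

End networks.

Section network_class.
Context {R : realType} (N : layer_norms R) (k : nat -> nat) (d : nat)
  (sigma : nat -> R -> R) (M : nat -> R).
Hypotheses (d_ge2 : (2 <= d)%N) (M_gt0 : forall i, (i < d)%N -> 0 < M i)
  (sigma_relu : forall i, (i < d.-1)%N -> sigma i = relu).

(** Convertible to [params_F] at [l2_norms] and to [params_1_inf] at [linf_norms], so that both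
    parts share one argument. *)
Definition norm_params : set (nn_params (R := R) k d) :=
  [set p | (forall i, (i < d.-1)%N -> mnorm N (p.1 i) <= M i) /\
           dnorm N p.2 <= M d.-1].

Let F := network_class sigma norm_params.
Let L := \prod_(i < d) M i.

Let prodE : L = (\prod_(i < d.-1) M i) * M d.-1.
Proof. by rewrite /L; move: d_ge2; case: (d) => // d' _; rewrite big_ord_recr. Qed.

Let M0 i : (i < d.-1)%N -> 0 < M i.
Proof. by move=> id; apply: M_gt0; move: d_ge2 id; case: (d) => //= d' _; exact: ltnW. Qed.

Let Mlast : 0 < M d.-1.
Proof. by apply: M_gt0; move: d_ge2; case: (d). Qed.

Lemma network_opp f : F f -> F (fun x => - f x).
Proof.
move=> [p [p1 p2] <-]; exists (p.1, - p.2); last first.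
  by apply/funext => x; rewrite /network/= linearN/= mulNmx mxE.
by split=> //=; rewrite dnormN.
Qed.

Lemma network_lipschitz f x y : F f -> `|f x - f y| <= L * l1norm (x - y).
Proof.
move=> [p [p1 p2] <-].
have -> : network sigma p x - network sigma p y =
    (p.2^T *m (hidden_layer sigma p.1 x d.-1 - hidden_layer sigma p.1 y d.-1)) 0 0.
  by rewrite mulmxBr [RHS]mxE [X in _ = _ + X]mxE.
apply: le_trans (vnorm_hoelder N _ _) _.
have := hidden_layer_lipschitz x y sigma_relu M0 p1.
have := vnorm_le_l1 N (x - y); have P0 : 0 < \prod_(i < d.-1) M i.
  by apply: prodr_gt0 => i _; exact: M0.
rewrite -(ler_pM2l P0) => h1 h2; have h := le_trans h2 h1.
rewrite prodE mulrAC [leRHS]mulrC.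
apply: le_trans (ler_wpM2r (vnorm_ge0 _ _) p2) _.
by rewrite ler_wpM2l// ltW.
Qed.

Lemma network_oscillation f x y (G : R) : F f -> 0 <= G ->
  l2norm x <= G -> l2norm y <= G -> `|f x - f y| <= L * G.
Proof.
move=> [p [p1 p2] <-] G0 xG yG.
have -> : network sigma p x - network sigma p y =
    (p.2^T *m (hidden_layer sigma p.1 x d.-1 - hidden_layer sigma p.1 y d.-1)) 0 0.
  by rewrite mulmxBr [RHS]mxE [X in _ = _ + X]mxE.
apply: le_trans (vnorm_hoelder N _ _) _.
have h : vnorm N (hidden_layer sigma p.1 x d.-1 - hidden_layer sigma p.1 y d.-1)
    <= (\prod_(i < d.-1) M i) * G.
  have xG' := le_trans (vnorm_le_l2 N x) xG; have yG' := le_trans (vnorm_le_l2 N y) yG.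
  move: p.1 p1 d_ge2 (M0) (sigma_relu) => W.
  (* Depth at least 2 supplies the ReLU layer whose nonnegative outputs save the factor 2. *)
  case: (d) => [//|[//|d']] /= q1 _ q2 q3; exact: hidden_layer_oscillation.
rewrite prodE mulrAC [leRHS]mulrC.
apply: le_trans (ler_wpM2r (vnorm_ge0 _ _) p2) _.
by rewrite ler_wpM2l// ltW.
Qed.

(** The output layer has no activation, so Hoelder's inequality alone removes it and only the [d.-1]
    hidden layers are charged. *)
Lemma network_sgn_sum (I : finType) (c : I -> R) (x : I -> 'cV[R]_(k 0%N))
    (f : {ffun I -> bool} -> 'cV[R]_(k 0%N) -> R) (a : R) :
    (forall e, F (f e)) -> 0 <= a ->
  mean (fun e => expR (a * \sum_s sgn e s * (c s * f e (x s)))) <=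
  2 ^+ d.-1 * mean (fun e => expR (a * L * vnorm N (\sum_s (sgn e s * c s) *: x s))).
Proof.
move=> Ff a0.
have /choice[p Hp] : forall e, exists p, norm_params p /\ network sigma p = f e.
  by move=> e; have [p ? ?] := Ff e; exists p.
apply: (@le_trans _ _ (mean (fun e => expR ((a * M d.-1) *
   vnorm N (\sum_s (sgn e s * c s) *: hidden_layer sigma (p e).1 (x s) d.-1))))).
  apply: mean_le => e; have [[p1 p2] <-] := Hp e.
  rewrite ler_expR -mulrA ler_wpM2l//.
  have -> : \sum_s sgn e s * (c s * network sigma (p e) (x s)) =
    ((p e).2^T *m \sum_s (sgn e s * c s) *: hidden_layer sigma (p e).1 (x s) d.-1) 0 0.
    rewrite mulmx_sumr summxE; apply: eq_bigr => s _.
    by rewrite -scalemxAr [RHS]mxE mulrA.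
  apply: le_trans (ler_norm _) _; apply: le_trans (vnorm_hoelder N _ _) _.
  by rewrite ler_wpM2r// vnorm_ge0.
apply: le_trans (peeling _ _ sigma_relu M0 _ _) _.
- by move=> e i id; have [[p1 _] _] := Hp e; exact: p1.
- by rewrite mulr_ge0// ltW.
rewrite ler_pM2l ?exprn_gt0//; apply: mean_le => e.
by rewrite prodE ler_expR -!mulrA ler_wpM2l// mulrCA.
Qed.

End network_class.

(** * The two families of norms *)

Section vector_norms.
Context {R : realType}.

(** Lagrange's identity: the double sum of squares is twice the difference of the two sides. *)
Lemma cauchy_schwarz (I : finType) (a b : I -> R) :
  (\sum_i a i * b i) ^+ 2 <= (\sum_i a i ^+ 2) * (\sum_i b i ^+ 2).
Proof.
have : 0 <= \sum_i \sum_j (a i * b j - a j * b i) ^+ 2.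
  by apply: sumr_ge0 => i _; apply: sumr_ge0 => j _; exact: sqr_ge0.
have -> : \sum_i \sum_j (a i * b j - a j * b i) ^+ 2 =
    \sum_i \sum_j (a i ^+ 2 * b j ^+ 2) + \sum_i \sum_j (a j ^+ 2 * b i ^+ 2)
    - 2 * \sum_i \sum_j ((a i * b i) * (a j * b j)).
  rewrite mulr_sumr -big_split -sumrB/=; apply: eq_bigr => i _.
  rewrite mulr_sumr -big_split -sumrB/=; apply: eq_bigr => j _; ring.
rewrite [X in _ + X - _]exchange_big/= expr2 !big_distrlr/=; lra.
Qed.

Lemma cauchy_schwarz_sqrt (I : finType) (a b : I -> R) :
  `|\sum_i a i * b i| <= Num.sqrt (\sum_i a i ^+ 2) * Num.sqrt (\sum_i b i ^+ 2).
Proof.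
rewrite -sqrtrM ?sumr_ge0// => [|i _]; last exact: sqr_ge0.
rewrite -sqrtr_sqr ler_wsqrtr//; exact: cauchy_schwarz.
Qed.

Lemma l2norm_ge0 n (x : 'cV[R]_n) : 0 <= l2norm x.
Proof. exact: sqrtr_ge0. Qed.

Lemma sqr_l2norm n (x : 'cV[R]_n) : l2norm x ^+ 2 = \sum_i x i 0 ^+ 2.
Proof. by rewrite sqr_sqrtr// sumr_ge0// => i _; exact: sqr_ge0. Qed.

Lemma l1norm_ge0 n (x : 'cV[R]_n) : 0 <= l1norm x.
Proof. by apply: sumr_ge0. Qed.

Lemma l2norm_le n (x : 'cV[R]_n) b : 0 <= b -> \sum_i x i 0 ^+ 2 <= b ^+ 2 -> l2norm x <= b.
Proof. by move=> b0 h; rewrite -(ger0_norm b0) -sqrtr_sqr ler_wsqrtr. Qed.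

Lemma l2normZ n a (x : 'cV[R]_n) : l2norm (a *: x) = `|a| * l2norm x.
Proof.
rewrite /l2norm -sqrtr_sqr -sqrtrM ?sqr_ge0// mulr_sumr; congr Num.sqrt.
by apply: eq_bigr => i _; rewrite mxE exprMn.
Qed.

Lemma l2normD n (x y : 'cV[R]_n) : l2norm (x + y) <= l2norm x + l2norm y.
Proof.
apply: l2norm_le; first by rewrite addr_ge0// l2norm_ge0.
rewrite sqrrD !sqr_l2norm.
have := le_trans (ler_norm _) (cauchy_schwarz_sqrt (fun i => x i 0) (fun i => y i 0)).
have -> : \sum_i (x + y) i 0 ^+ 2 =
    \sum_i x i 0 ^+ 2 + (\sum_i x i 0 * y i 0) *+ 2 + \sum_i y i 0 ^+ 2.
  rewrite -sumrMnl -!big_split/=; apply: eq_bigr => i _; rewrite mxE; ring.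
by rewrite -/(l2norm x) -/(l2norm y); lra.
Qed.

Lemma l2norm_sub n (x y : 'cV[R]_n) : `|l2norm x - l2norm y| <= l2norm (x - y).
Proof.
have h1 := l2normD (x - y) y; have := l2normD (y - x) x.
have -> : l2norm (y - x) = l2norm (x - y).
  by rewrite -(opprB x y) -scaleN1r l2normZ normrN normr1 mul1r.
rewrite !subrK in h1 *; rewrite ler_norml; lra.
Qed.

Lemma l2norm_le_l1 n (x : 'cV[R]_n) : l2norm x <= l1norm x.
Proof.
apply: l2norm_le; first exact: l1norm_ge0.
rewrite expr2 /l1norm big_distrlr/=; apply: ler_sum => i _.
rewrite (bigD1 i)//= -[leLHS]addr0 -expr2 real_normK ?num_real// lerD2l.
by apply: sumr_ge0 => j _; rewrite mulr_ge0.
Qed.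

Lemma dotE n (w x : 'cV[R]_n) : (w^T *m x) 0 0 = \sum_i w i 0 * x i 0.
Proof. by rewrite mxE; apply: eq_bigr => i _; rewrite mxE. Qed.

Lemma normr_le_l2norm n (x : 'cV[R]_n) i : `|x i 0| <= l2norm x.
Proof.
rewrite -sqrtr_sqr ler_wsqrtr// (bigD1 i)//= lerDl.
by apply: sumr_ge0 => j _; exact: sqr_ge0.
Qed.

Definition linfnorm n (x : 'cV[R]_n) : R := \big[Num.max/0]_i `|x i 0|.

Lemma linfnorm_le n (x : 'cV[R]_n) b :
  0 <= b -> (forall i, `|x i 0| <= b) -> linfnorm x <= b.
Proof. by move=> b0 h; apply/bigmax_leP; split. Qed.

Lemma normr_le_linfnorm n (x : 'cV[R]_n) i : `|x i 0| <= linfnorm x.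
Proof. exact: le_bigmax. Qed.

Lemma linfnorm_ge0 n (x : 'cV[R]_n) : 0 <= linfnorm x.
Proof. exact: bigmax_ge_id. Qed.

Lemma row_dot_l2 m n (W : 'M[R]_(m, n)) (z : 'cV[R]_n) j :
  `|(W *m z) j 0| <= Num.sqrt (\sum_i W j i ^+ 2) * l2norm z.
Proof. by rewrite mxE; exact: cauchy_schwarz_sqrt. Qed.

Fact l2_hoelder n (w x : 'cV[R]_n) : `|(w^T *m x) 0 0| <= l2norm w * l2norm x.
Proof. by rewrite dotE; exact: cauchy_schwarz_sqrt. Qed.

Fact l2_dominated m n (W : 'M[R]_(m, n)) (y : 'cV[R]_m) (b : R) : 0 <= b ->
    (forall j, exists2 z, l2norm z <= b & `|y j 0| <= `|(W *m z) j 0|) ->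
  l2norm y <= frobenius_norm W * b.
Proof.
move=> b0 H; apply: l2norm_le; first by rewrite mulr_ge0// sqrtr_ge0.
have S0 j : 0 <= \sum_i W j i ^+ 2 by apply: sumr_ge0 => i _; exact: sqr_ge0.
rewrite exprMn sqr_sqrtr ?sumr_ge0// mulr_suml; apply: ler_sum => j _.
have [z zb h] := H j.
rewrite -(sqr_sqrtr (S0 j)) -exprMn -(real_normK (num_real (y j 0))).
rewrite lerXn2r ?nnegrE ?mulr_ge0 ?sqrtr_ge0//.
apply: le_trans h _; apply: le_trans (row_dot_l2 _ _ _) _.
by rewrite ler_wpM2l// sqrtr_ge0.
Qed.

(* Among the rows of [W] the selected one maximises the ratio between its
   contribution and its norm; junk values [0 / 0 = 0] take care of null rows. *)
Fact l2_selection m n (W : 'M[R]_(m, n)) (M : R) (I : finType) (c : I -> R)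
    (z : I -> 'cV[R]_n) : frobenius_norm W <= M -> 0 <= M ->
  exists2 u : 'cV[R]_n, l2norm u <= M &
    l2norm (\sum_s c s *: map_mx relu (W *m z s)) <=
    `|\sum_s c s * relu ((u^T *m z s) 0 0)|.
Proof.
move=> WM M0; case: m W WM => [|m] W WM.
  exists 0; first by apply: l2norm_le => //; rewrite big1 ?sqr_ge0// => i _; rewrite mxE expr0n.
  by rewrite /l2norm big_ord0 sqrtr0.
pose A j := \sum_s c s * relu ((W *m z s) j 0).
pose C j := Num.sqrt (\sum_i W j i ^+ 2).
have S0 j : 0 <= \sum_i W j i ^+ 2 by apply: sumr_ge0 => i _; exact: sqr_ge0.
have C0 j : 0 <= C j by exact: sqrtr_ge0.
have AC j : C j = 0 -> A j = 0.
  move=> Cj; rewrite /A big1// => s _.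
  have := row_dot_l2 W (z s) j; rewrite -/(C j) Cj mul0r normr_le0 => /eqP ->.
  by rewrite relu0 mulr0.
pose j := [arg max_(j > (ord0 : 'I_m.+1)) (`|A j| / C j)]%O.
have Hj i : `|A i| / C i <= `|A j| / C j.
  by rewrite /j; case: Order.TotalTheory.arg_maxP => // j' _; exact.
have WjE s : ((M / C j) *: (row j W)^T)^T *m z s = (M / C j) *: row j (W *m z s).
  by rewrite linearZ/= trmxK -scalemxAl row_mul.
have MC0 : 0 <= M / C j by rewrite divr_ge0.
exists ((M / C j) *: (row j W)^T).
  rewrite l2normZ ger0_norm// /l2norm.
  under eq_bigr do rewrite !mxE.
  rewrite -/(C j); have [->|Cj] := eqVneq (C j) 0; first by rewrite mulr0.
  by rewrite divfK.
have -> : \sum_s c s * relu ((((M / C j) *: (row j W)^T)^T *m z s) 0 0) = (M / C j) * A j.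
  rewrite /A mulr_sumr; apply: eq_bigr => s _.
  by rewrite WjE [X in relu X]mxE [X in relu (_ * X)]mxE reluZ// mulrCA.
rewrite normrM (ger0_norm MC0) mulrAC -mulrA.
have q0 : 0 <= `|A j| / C j by rewrite divr_ge0.
apply: l2norm_le; first by rewrite mulr_ge0.
have -> : \sum_i (\sum_s c s *: map_mx relu (W *m z s)) i 0 ^+ 2 = \sum_i A i ^+ 2.
  apply: eq_bigr => i _; congr (_ ^+ 2); rewrite summxE; apply: eq_bigr => s _.
  by rewrite mxE [X in _ * X]mxE.
(* Entry [i] is at most [C i] times the maximal ratio, and the [C i ^+ 2] add up to the squared
   Frobenius norm. *)
apply: (@le_trans _ _ (\sum_i (C i ^+ 2) * (`|A j| / C j) ^+ 2)).
  apply: ler_sum => i _; rewrite -exprMn -(real_normK (num_real (A i))).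
  rewrite lerXn2r ?nnegrE ?mulr_ge0 ?invr_ge0//.
  have [Ci|Ci] := eqVneq (C i) 0; first by rewrite (AC _ Ci) normr0 mulr_ge0.
  have Ci0 : 0 < C i by rewrite lt_neqAle eq_sym Ci C0.
  by have := Hj i; rewrite ler_pdivrMr// mulrC.
rewrite -mulr_suml [leRHS]exprMn; apply: ler_wpM2r; first exact: sqr_ge0.
under eq_bigr do rewrite (sqr_sqrtr (S0 _)).
rewrite -[leLHS]sqr_sqrtr ?sumr_ge0// lerXn2r ?nnegrE ?sqrtr_ge0//.
Qed.

Fact l1normN n (w : 'cV[R]_n) : l1norm (- w) = l1norm w.
Proof. by apply: eq_bigr => i _; rewrite mxE normrN. Qed.

Fact l2normN n (w : 'cV[R]_n) : l2norm (- w) = l2norm w.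
Proof. by rewrite -scaleN1r l2normZ normrN normr1 mul1r. Qed.

Definition l2_norms : layer_norms R :=
  LayerNorms (fun n => @l2norm_ge0 n) (fun n => @l2normN n) (fun n => @l2_hoelder n)
    (fun m n => @l2_dominated m n) (fun m n => @l2_selection m n)
    (fun n => @l2norm_le_l1 n) (fun n x => lexx (l2norm x)).

Fact linf_hoelder n (w x : 'cV[R]_n) : `|(w^T *m x) 0 0| <= l1norm w * linfnorm x.
Proof.
rewrite dotE (le_trans (ler_norm_sum _ _ _))// mulr_suml; apply: ler_sum => i _.
by rewrite normrM ler_wpM2l// normr_le_linfnorm.
Qed.

Fact row_dot_linf m n (W : 'M[R]_(m, n)) (z : 'cV[R]_n) j :
  `|(W *m z) j 0| <= (\sum_i `|W j i|) * linfnorm z.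
Proof.
rewrite mxE (le_trans (ler_norm_sum _ _ _))// mulr_suml; apply: ler_sum => i _.
by rewrite normrM ler_wpM2l// normr_le_linfnorm.
Qed.

Fact linf_dominated m n (W : 'M[R]_(m, n)) (y : 'cV[R]_m) (b : R) : 0 <= b ->
    (forall j, exists2 z, linfnorm z <= b & `|y j 0| <= `|(W *m z) j 0|) ->
  linfnorm y <= norm_1_inf W * b.
Proof.
move=> b0 H; apply: linfnorm_le => [|j].
  by rewrite mulr_ge0//; exact: bigmax_ge_id.
have [z zb h] := H j; apply: le_trans h _; apply: le_trans (row_dot_linf _ _ _) _.
apply: ler_pM => //; [exact: sumr_ge0|exact: linfnorm_ge0|exact: le_bigmax].
Qed.

(** The maximum norm is read off at one coordinate, and the corresponding row of [W] is itself an
    admissible weight vector. *)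
Fact linf_selection m n (W : 'M[R]_(m, n)) (M : R) (I : finType) (c : I -> R)
    (z : I -> 'cV[R]_n) : norm_1_inf W <= M -> 0 <= M ->
  exists2 u : 'cV[R]_n, l1norm u <= M &
    linfnorm (\sum_s c s *: map_mx relu (W *m z s)) <=
    `|\sum_s c s * relu ((u^T *m z s) 0 0)|.
Proof.
move=> WM M0; case: m W WM => [|m] W WM.
  exists 0; first by rewrite /l1norm big1// => i _; rewrite mxE normr0.
  by rewrite /linfnorm big_ord0.
pose y := \sum_s c s *: map_mx relu (W *m z s).
pose j := [arg max_(j > (ord0 : 'I_m.+1)) `|y j 0|]%O.
exists (row j W)^T.
  apply: le_trans WM; rewrite /l1norm; under eq_bigr do rewrite !mxE.
  exact: le_bigmax.
rewrite -/y; apply: linfnorm_le => // i.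
apply: (@le_trans _ _ `|y j 0|).
  by rewrite /j; case: Order.TotalTheory.arg_maxP => // j' _; exact.
rewrite le_eqVlt; apply/orP; left; apply/eqP; congr (`| _ |).
rewrite /y summxE; apply: eq_bigr => s _.
by rewrite mxE [X in _ * X]mxE trmxK -row_mul; congr (_ * relu _); rewrite [RHS]mxE.
Qed.

Fact linfnorm_le_l2 n (x : 'cV[R]_n) : linfnorm x <= l2norm x.
Proof. by apply: linfnorm_le => [|i]; [exact: l2norm_ge0|exact: normr_le_l2norm]. Qed.

Definition linf_norms : layer_norms R :=
  LayerNorms (fun n => @linfnorm_ge0 n) (fun n => @l1normN n) (fun n => @linf_hoelder n)
    (fun m n => @linf_dominated m n) (fun m n => @linf_selection m n)
    (fun n x => le_trans (linfnorm_le_l2 x) (l2norm_le_l1 x)) (fun n => @linfnorm_le_l2 n).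

(** McDiarmid's inequality for the norm of a signed sum. Its mean is at most the root of its second
    moment, which the orthogonality of the signs reduces to the sum of the squared norms of the
    summands. *)
Lemma mean_expR_l2norm n (I : finType) (c : I -> R) (x : I -> 'cV[R]_n) (a G : R) :
    0 <= a -> 0 <= G -> (forall s, l2norm (x s) <= G) ->
  mean (fun e => expR (a * l2norm (\sum_s (sgn e s * c s) *: x s))) <=
  expR (a * (G * Num.sqrt (\sum_s c s ^+ 2)) + a ^+ 2 * (G ^+ 2 * \sum_s c s ^+ 2) / 2).
Proof.
move=> a0 G0 xG.
pose Z e := l2norm (\sum_s (sgn e s * c s) *: x s).
have V0 : 0 <= \sum_s c s ^+ 2 by apply: sumr_ge0 => s _; exact: sqr_ge0.
have diff s e : `|a * Z e - a * Z (flip s e)| <= 2 * (a * (`|c s| * G)).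
  rewrite -mulrBr normrM ger0_norm// mulrCA ler_wpM2l//.
  apply: le_trans (l2norm_sub _ _) _.
  rewrite (bigD1 s)//= [X in _ - X](bigD1 s)//= sgn_flip.
  under [X in _ - (_ + X)]eq_bigr do rewrite sgn_flip_neq//.
  rewrite opprD addrACA subrr addr0 mulNr scaleNr opprK -scalerDl l2normZ.
  have -> : sgn e s * c s + sgn e s * c s = 2 * (sgn e s * c s) by lra.
  rewrite !normrM normr_sgn mul1r ger0_norm// -mulrA ler_wpM2l//.
  by rewrite ler_wpM2l.
have EZ : mean Z <= G * Num.sqrt (\sum_s c s ^+ 2).
  have Z0 : 0 <= mean Z by apply: mean_ge0 => e; exact: l2norm_ge0.
  rewrite -[leLHS]ger0_norm// -sqrtr_sqr -[X in X * _](ger0_norm G0) -sqrtr_sqr.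
  rewrite -sqrtrM ?sqr_ge0// ler_wsqrtr//.
  apply: le_trans (sqr_mean_le _) _.
  have -> : mean (fun e => Z e ^+ 2) =
      mean (fun e => \sum_i (\sum_s sgn e s * (c s * x s i 0)) ^+ 2).
    apply: eq_mean => e; rewrite sqr_l2norm; apply: eq_bigr => i _; congr (_ ^+ 2).
    by rewrite summxE; apply: eq_bigr => s _; rewrite mxE mulrA.
  rewrite mean_sum; under eq_bigr do rewrite mean_sqr_sgn_sum.
  rewrite exchange_big/= mulr_sumr; apply: ler_sum => s _.
  under eq_bigr do rewrite exprMn.
  rewrite -mulr_sumr -sqr_l2norm mulrC ler_wpM2r ?sqr_ge0//.
  by rewrite lerXn2r ?nnegrE ?l2norm_ge0.
apply: le_trans (cube_mcdiarmid diff) _; rewrite ler_expR meanZ lerD//.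
  by rewrite ler_wpM2l.
rewrite ler_pM2r// mulrA mulr_sumr; apply: ler_sum => s _.
by rewrite !exprMn real_normK ?num_real//; lra.
Qed.

(** The exponential of a maximum is at most the sum of the exponentials over the [n] coordinates;
    the 2 comes from the absolute values. *)
Lemma mean_expR_linfnorm n (I : finType) (c : I -> R) (x : I -> 'cV[R]_n) (a G : R) :
    (0 < n)%N -> 0 <= a -> 0 <= G -> (forall s, l2norm (x s) <= G) ->
  mean (fun e => expR (a * linfnorm (\sum_s (sgn e s * c s) *: x s))) <=
  2 * n%:R * expR (a ^+ 2 * (G ^+ 2 * \sum_s c s ^+ 2) / 2).
Proof.
case: n x => // n x _ a0 G0 xG.
pose Y e i := \sum_s sgn e s * (a * (c s * x s i 0)).
apply: (@le_trans _ _ (mean (fun e => \sum_i expR `|Y e i|))).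
  apply: mean_le => e; pose y := \sum_s (sgn e s * c s) *: x s; rewrite -/y.
  have [i _ ->] : exists2 i, true & linfnorm y = `|y i 0|.
    rewrite /linfnorm (bigmax_eq_arg 0 ord0)//.
    by exists [arg max_(i > (ord0 : 'I_n.+1)) `|y i 0|]%O.
  rewrite -{1}(ger0_norm a0) -normrM.
  have -> : a * y i 0 = Y e i.
    rewrite /y summxE mulr_sumr; apply: eq_bigr => s _; rewrite mxE; ring.
  by rewrite (bigD1 i)//= lerDl sumr_ge0// => j _; exact: expR_ge0.
rewrite mean_sum.
apply: (@le_trans _ _ (\sum_(i < n.+1) 2 * expR (a ^+ 2 * (G ^+ 2 * \sum_s c s ^+ 2) / 2))).
  apply: ler_sum => i _; apply: le_trans (mean_expR_norm_sgn_sum _) _.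
  rewrite ler_pM2l// ler_expR ler_pM2r// mulrA mulr_sumr; apply: ler_sum => s _.
  rewrite !exprMn -mulrA ler_wpM2l ?sqr_ge0// mulrC ler_wpM2r ?sqr_ge0//.
  rewrite -(real_normK (num_real (x s i 0))) lerXn2r ?nnegrE//.
  by apply: le_trans (xG s); exact: normr_le_l2norm.
by rewrite sumr_const card_ord -[leLHS]mulr_natl mulrA (mulrC _ 2).
Qed.

End vector_norms.

(** * Rademacher bounds and concentration on a finite alphabet *)

Section rademacher.
Context {R : realType}.

(* Selecting a function for each sign vector avoids suprema over the class. *)
Definition rademacher_le h (F : set ('cV[R]_h -> R)) (G rho : R) : Prop :=
  forall (I : finType) (c : I -> R) (x : I -> 'cV[R]_h)
    (f : {ffun I -> bool} -> 'cV[R]_h -> R),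
    (forall s, l2norm (x s) <= G) -> 0 < \sum_s c s ^+ 2 ->
    (forall e, F (f e)) ->
  mean (fun e => \sum_s sgn e s * (c s * f e (x s))) <=
  rho * Num.sqrt (\sum_s c s ^+ 2).

Context (k : nat -> nat) (d : nat) (sigma : nat -> R -> R) (M : nat -> R) (G : R).
Hypotheses (d_ge2 : (2 <= d)%N) (M_gt0 : forall i, (i < d)%N -> 0 < M i)
  (sigma_relu : forall i, (i < d.-1)%N -> sigma i = relu) (G_gt0 : 0 < G).

Let L := \prod_(i < d) M i.

Let L_gt0 : 0 < L. Proof. by apply: prodr_gt0 => i _; exact: M_gt0. Qed.

Let LG_gt0 : 0 < L * G. Proof. exact: mulr_gt0. Qed.

(** The term [d.-1%:R * ln 2] is the logarithm of the peeling factor; the summand 1 is the mean of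
    the norm of the signed sum of inputs. *)
Lemma rademacher_l2 :
  rademacher_le (network_class sigma (norm_params l2_norms (k := k) (d := d) M)) G
    (L * G * (Num.sqrt (2 * (d.-1%:R * ln 2)) + 1)).
Proof.
move=> I c x f xG V0 Ff.
set V := \sum_s c s ^+ 2 in V0 *.
have ln20 : 0 < ln (2 : R) by rewrite ln_gt0// ltr1n.
have d1 : 0 < d.-1%:R :> R by rewrite ltr0n; move: d_ge2; case: (d) => [//|[]].
have := @mean_le_of_expR _ _ (fun e => \sum_s sgn e s * (c s * f e (x s)))
  (d.-1%:R * ln 2) (L * G * Num.sqrt V) ((L * G) ^+ 2 * V).
have -> : L * G * Num.sqrt V + Num.sqrt (2 * (d.-1%:R * ln 2) * ((L * G) ^+ 2 * V)) =
    L * G * (Num.sqrt (2 * (d.-1%:R * ln 2)) + 1) * Num.sqrt V.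
  rewrite sqrtrM; last by rewrite !mulr_ge0// ltW.
  rewrite [Num.sqrt (_ * V)]sqrtrM ?sqr_ge0// sqrtr_sqr gtr0_norm//; ring.
apply; [by rewrite mulr_gt0|by rewrite mulr_gt0// exprn_gt0|move=> a a0].
apply: le_trans (network_sgn_sum d_ge2 M_gt0 sigma_relu _ _ Ff (ltW a0)) _.
have aL0 : 0 <= a * L by rewrite mulr_ge0// ltW.
have -> : (2 : R) ^+ d.-1 = expR (d.-1%:R * ln 2).
  by rewrite expRM_natl lnK// posrE.
rewrite -addrA [leRHS]expRD ler_pM2l ?expR_gt0//.
apply: le_trans (mean_expR_l2norm _ aL0 (ltW G_gt0) xG) _.
by rewrite ler_expR -/V; lra.
Qed.

Lemma rademacher_linf (h_gt0 : (0 < k 0)%N) :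
  rademacher_le (network_class sigma (norm_params linf_norms (k := k) (d := d) M)) G
    (L * G * Num.sqrt (2 * (d%:R * ln 2 + ln (k 0)%:R))).
Proof.
move=> I c x f xG V0 Ff.
set V := \sum_s c s ^+ 2 in V0 *.
have ln20 : 0 < ln (2 : R) by rewrite ln_gt0// ltr1n.
have lnk : 0 <= ln ((k 0)%:R : R) by rewrite ln_ge0// ler1n.
have d0 : 0 < d%:R :> R by rewrite ltr0n; move: d_ge2; case: (d).
have a1 : 0 < d%:R * ln 2 + ln ((k 0)%:R : R) by rewrite ltr_pwDl// mulr_gt0.
have := @mean_le_of_expR _ _ (fun e => \sum_s sgn e s * (c s * f e (x s)))
  (d%:R * ln 2 + ln (k 0)%:R) 0 ((L * G) ^+ 2 * V).
have -> : 0 + Num.sqrt (2 * (d%:R * ln 2 + ln (k 0)%:R) * ((L * G) ^+ 2 * V)) =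
    L * G * Num.sqrt (2 * (d%:R * ln 2 + ln (k 0)%:R)) * Num.sqrt V.
  rewrite add0r sqrtrM; last by rewrite mulr_ge0// ltW.
  rewrite [Num.sqrt (_ * V)]sqrtrM ?sqr_ge0// sqrtr_sqr gtr0_norm//; ring.
apply; [by []|by rewrite mulr_gt0// exprn_gt0|move=> a a0].
apply: le_trans (network_sgn_sum d_ge2 M_gt0 sigma_relu _ _ Ff (ltW a0)) _.
have aL0 : 0 <= a * L by rewrite mulr_ge0// ltW.
apply: le_trans (ler_wpM2l _ (mean_expR_linfnorm _ h_gt0 aL0 (ltW G_gt0) xG)) _.
  by rewrite exprn_ge0.
rewrite mulr0 addr0 [leRHS]expRD expRD expRM_natl !lnK ?posrE ?ltr0n//.
(* The two signs of a coordinate contribute the factor that completes [2 ^+ d.-1] to [2 ^+ d]. *)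
have -> : (2 : R) ^+ d = 2 ^+ d.-1 * 2 by rewrite -exprSr prednK// ltnW.
rewrite !mulrA ler_pM2l ?mulr_gt0 ?exprn_gt0 ?ltr0n// ler_expR -/V; lra.
Qed.

End rademacher.

Section product_weights.
Context {R : realType} {I A : finType} (p : I -> A -> R).
Hypotheses (p_ge0 : forall s a, 0 <= p s a) (p_sum1 : forall s, \sum_a p s a = 1).

Definition weight (a : {ffun I -> A}) : R := \prod_s p s (a s).

Lemma weight_ge0 a : 0 <= weight a.
Proof. by apply: prodr_ge0. Qed.

Lemma sum_weight : \sum_a weight a = 1.
Proof. by rewrite -[LHS](bigA_distr_bigA p) big1. Qed.

Lemma weight_marginal s (g : A -> R) :
  \sum_a weight a * g (a s) = \sum_b p s b * g b.
Proof.
pose q u b := p u b * (if u == s then g b else 1).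
have -> : \sum_a weight a * g (a s) = \sum_(a : {ffun I -> A}) \prod_u q u (a u).
  apply: eq_bigr => a _; rewrite /q big_split/=; congr (_ * _).
  by rewrite (bigD1 s)//= eqxx big1 ?mulr1// => u /negbTE ->.
rewrite -(bigA_distr_bigA q) (bigD1 s)//= [X in _ * X]big1 ?mulr1.
  by apply: eq_bigr => b _; rewrite /q eqxx.
move=> u us; rewrite /q (negbTE us); under eq_bigr do rewrite mulr1; exact: p_sum1.
Qed.

Definition mix (e : {ffun I -> bool}) (a b : {ffun I -> A}) : {ffun I -> A} :=
  [ffun s => if e s then b s else a s].

(** Exchangeability of sample and ghost sample: values are swapped within a coordinate, where both
    follow the same law [p s]. The law may vary with [s], so the samples from [mu] and [nu] are
    treated as one. *)
Lemma sum_weight_mix (H : {ffun I -> A} -> {ffun I -> A} -> R) e :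
  \sum_a \sum_b weight a * weight b * H (mix e a b) (mix e b a) =
  \sum_a \sum_b weight a * weight b * H a b.
Proof.
rewrite !pair_big/=.
pose swap (ab : {ffun I -> A} * {ffun I -> A}) := (mix e ab.1 ab.2, mix e ab.2 ab.1).
have swapK : involutive swap.
  by move=> [a b]; congr pair; apply/ffunP => s; rewrite !ffunE/=; case: (e s).
rewrite [RHS](reindex_inj (inv_inj swapK)); apply: eq_bigr => -[a b] _ /=.
congr (_ * _); rewrite /weight -!big_split/=; apply: eq_bigr => s _.
by rewrite !ffunE; case: (e s) => //; rewrite mulrC.
Qed.

End product_weights.

Section discrete_concentration.
Context {R : realType} {I A : finType} (p : I -> A -> R) (h : nat)
  (F : set ('cV[R]_h -> R)) (z : A -> 'cV[R]_h) (c : I -> R) (G b rho : R).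
Hypotheses (p_ge0 : forall s a, 0 <= p s a) (p_sum1 : forall s, \sum_a p s a = 1)
  (F0 : F !=set0) (zG : forall a, l2norm (z a) <= G)
  (osc : forall f x y, F f -> l2norm x <= G -> l2norm y <= G -> `|f x - f y| <= b)
  (Frad : rademacher_le F G rho) (b_gt0 : 0 < b) (V_gt0 : 0 < \sum_s c s ^+ 2).

Let V := \sum_s c s ^+ 2.

Let signed_dev (a a' : {ffun I -> A}) (e : {ffun I -> bool}) (f : 'cV[R]_h -> R) : R :=
  \sum_s sgn e s * (c s * (f (z (a s)) - f (z (a' s)))).

Let supdev a a' e : R := sup [set signed_dev a a' e f | f in F].

Let has_sup_dev a a' e : has_sup [set signed_dev a a' e f | f in F].
Proof.
split; first by have [f Ff] := F0; exists (signed_dev a a' e f), f.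
exists (\sum_s `|c s| * b) => _ [f Ff <-]; apply: ler_sum => s _.
apply: le_trans (ler_norm _) _; rewrite !normrM normr_sgn mul1r ler_wpM2l//.
exact: osc.
Qed.

Let le_supdev a a' e f : F f -> signed_dev a a' e f <= supdev a a' e.
Proof. by move=> Ff; apply: ub_le_sup; [case: (has_sup_dev a a' e)|exists f]. Qed.

(** A summand involves [f] only through a difference of two values on the ball, so the oscillation
    [b] enters here and not the sup norm. *)
Let supdev_flip a a' s e :
  supdev a a' e <= supdev a a' (flip s e) + 2 * (`|c s| * b).
Proof.
apply: ge_sup; first by case: (has_sup_dev a a' e).
move=> _ [f Ff <-]; apply: (@le_trans _ _ (signed_dev a a' (flip s e) f + 2 * (`|c s| * b))).
  rewrite /signed_dev (bigD1 s)//= [X in _ <= X + _](bigD1 s)//= sgn_flip.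
  under [X in _ <= _ + X + _]eq_bigr do rewrite sgn_flip_neq//.
  have : `|sgn e s * (c s * (f (z (a s)) - f (z (a' s))))| <= `|c s| * b.
    by rewrite !normrM normr_sgn mul1r ler_wpM2l//; exact: osc.
  have := ler_norm (sgn e s * (c s * (f (z (a s)) - f (z (a' s))))).
  lra.
by rewrite lerD2r le_supdev.
Qed.

(** Functions within [eta] of the supremum give one Rademacher sum on the sample and one on the
    ghost sample; negating all signs absorbs the minus sign of the latter. Hence [2 * rho]. *)
Let mean_supdev a a' : mean (supdev a a') <= 2 * (rho * Num.sqrt V).
Proof.
apply/ler_addgt0Pr => eta eta0.
have /choice[f Hf] : forall e, exists f, F f /\ supdev a a' e <= signed_dev a a' e f + eta.
  move=> e; have [_ [f Ff <-] h'] := sup_adherent eta0 (has_sup_dev a a' e).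
  by exists f; split => //; move: h'; rewrite -/(supdev a a' e); lra.
have h1 := Frad (fun s => zG (a s)) V_gt0 (fun e => (Hf e).1).
have h2 := Frad (fun s => zG (a' s)) V_gt0 (fun e => (Hf (neg e)).1).
rewrite -/V in h1 h2.
have : mean (supdev a a') <= mean (fun e => signed_dev a a' e (f e)) + eta.
  by rewrite -[X in _ <= _ + X](@mean_cst _ I) -meanD; apply: mean_le => e; case: (Hf e).
have -> : mean (fun e => signed_dev a a' e (f e)) =
    mean (fun e => \sum_s sgn e s * (c s * f e (z (a s)))) +
    mean (fun e => \sum_s sgn e s * (c s * f (neg e) (z (a' s)))).
  rewrite -[X in _ + X]mean_neg -meanD; apply: eq_mean => e.
  rewrite -big_split/=; apply: eq_bigr => s _; rewrite negK sgn_neg; ring.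
lra.
Qed.

Let mean_expR_supdev a a' (l : R) : 0 <= l ->
  mean (fun e => expR (l * supdev a a' e)) <=
  expR (l * (2 * (rho * Num.sqrt V)) + l ^+ 2 * (b ^+ 2 * V) / 2).
Proof.
move=> l0.
have diff s e : `|l * supdev a a' e - l * supdev a a' (flip s e)| <= 2 * (l * (`|c s| * b)).
  rewrite -mulrBr normrM ger0_norm// mulrCA ler_wpM2l//.
  have := supdev_flip a a' s e; have := supdev_flip a a' s (flip s e).
  by rewrite flipK ler_norml; lra.
apply: le_trans (cube_mcdiarmid diff) _; rewrite ler_expR meanZ lerD//.
  by rewrite ler_wpM2l// mean_supdev.
rewrite ler_pM2r// mulrA mulr_sumr; apply: ler_sum => s _.
by rewrite !exprMn real_normK ?num_real//; lra.
Qed.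

(** Markov's inequality in exponential form. The witness [f] of a bad [a] is fixed before the ghost
    sample [a'] is averaged, so the expectation of [f] becomes that average and Jensen's inequality
    takes it out of the exponential. *)
Lemma discrete_chernoff (Bad : pred {ffun I -> A}) (t l : R) : 0 <= l ->
    (forall a, Bad a -> exists2 f, F f &
       t <= \sum_s c s * (f (z (a s)) - \sum_b p s b * f (z b))) ->
  \sum_(a | Bad a) weight p a <=
  expR (l * (2 * (rho * Num.sqrt V)) + l ^+ 2 * (b ^+ 2 * V) / 2 - l * t).
Proof.
move=> l0 HBad.
(* The value [false] encodes the sign +1. *)
pose e0 : {ffun I -> bool} := [ffun => false].
pose H a a' := expR (l * supdev a a' e0).
have step1 a : Bad a -> 1 <= expR (- (l * t)) * \sum_a' weight p a' * H a a'.
  move=> /HBad[f Ff tf].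
  pose T := \sum_s c s * (f (z (a s)) - \sum_b p s b * f (z b)).
  apply: (@le_trans _ _ (expR (- (l * t)) * expR (l * T))).
    by rewrite -expRD -expR0 ler_expR; have := ler_wpM2l l0 tf; rewrite -/T; lra.
  rewrite ler_pM2l ?expR_gt0//.
  have -> : l * T = \sum_a' weight p a' * (l * signed_dev a a' e0 f).
    have -> : \sum_a' weight p a' * (l * signed_dev a a' e0 f) =
        l * \sum_a' weight p a' * signed_dev a a' e0 f.
      by rewrite mulr_sumr; apply: eq_bigr => a' _; rewrite mulrCA.
    congr (_ * _); rewrite /signed_dev.
    under eq_bigr do rewrite mulr_sumr.
    rewrite exchange_big/=; apply: eq_bigr => s _.
    rewrite -(weight_marginal p_sum1 s (fun b => f (z b))).
    rewrite -[in LHS](mulr1 (f (z (a s)))) -{1}(sum_weight p_sum1).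
    rewrite mulr_sumr -sumrB mulr_sumr; apply: eq_bigr => a' _.
    by rewrite /sgn ffunE expr0; ring.
  apply: le_trans (expR_jensen _ (weight_ge0 p_ge0) (sum_weight p_sum1)) _.
  apply: ler_sum => a' _; rewrite ler_wpM2l ?weight_ge0// ler_expR ler_wpM2l//.
  exact: le_supdev.
apply: (@le_trans _ _ (\sum_a \sum_a' weight p a * weight p a' * (expR (- (l * t)) * H a a'))).
  rewrite big_mkcond; apply: ler_sum => a _.
  have -> : \sum_a' weight p a * weight p a' * (expR (- (l * t)) * H a a') =
      weight p a * (expR (- (l * t)) * \sum_a' weight p a' * H a a').
    by rewrite !mulr_sumr; apply: eq_bigr => a' _; ring.
  case: ifPn => [/step1 h'|_]; first by rewrite -[leLHS]mulr1 ler_wpM2l ?weight_ge0.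
  rewrite mulr_ge0 ?weight_ge0// mulr_ge0 ?expR_ge0//.
  by apply: sumr_ge0 => a' _; rewrite mulr_ge0 ?weight_ge0// expR_ge0.
have -> : \sum_a \sum_a' weight p a * weight p a' * (expR (- (l * t)) * H a a') =
    mean (fun e => \sum_a \sum_a' weight p a * weight p a' *
                     (expR (- (l * t)) * expR (l * supdev a a' e))).
  rewrite -[LHS](@mean_cst _ I); apply: eq_mean => e.
  (* Exchanging the coordinates where [e] is true reverses exactly those differences, so [e0] may be
     replaced by any [e], and then by the mean over all of them. *)
  rewrite -(sum_weight_mix p (fun a a' => expR (- (l * t)) * H a a') e).
  apply: eq_bigr => a _; apply: eq_bigr => a' _; congr (_ * (_ * expR (_ * sup _))).
  apply: eq_imagel => f Ff; apply: eq_bigr => s _.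
  by rewrite !ffunE /sgn ffunE; case: (e s); rewrite ?expr0 ?expr1; ring.
rewrite mean_sum; under eq_bigr do rewrite mean_sum.
set B := expR (_ - _).
apply: (@le_trans _ _ (\sum_a \sum_a' weight p a * weight p a' * B)).
  apply: ler_sum => a _; apply: ler_sum => a' _.
  rewrite meanZ meanZ ler_wpM2l ?mulr_ge0 ?weight_ge0//.
  rewrite /B addrC expRD ler_pM2l ?expR_gt0//; exact: mean_expR_supdev.
under eq_bigr do (under eq_bigr do rewrite -mulrA).
under eq_bigr do rewrite -mulr_sumr -mulr_suml (sum_weight p_sum1) mul1r.
by rewrite -mulr_suml sum_weight// mul1r.
Qed.

Lemma discrete_concentration (Bad : pred {ffun I -> A}) (t delta : R) :
    0 < delta -> delta < 1 ->
    2 * (rho * Num.sqrt V) + b * Num.sqrt (2 * ln (1 / delta)) * Num.sqrt V <= t ->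
    (forall a, Bad a -> exists2 f, F f &
       t <= \sum_s c s * (f (z (a s)) - \sum_b p s b * f (z b))) ->
  \sum_(a | Bad a) weight p a <= delta.
Proof.
move=> d0 d1 tge HBad.
have l0 : 0 < ln (1 / delta) by rewrite ln_gt0// ltr_pdivlMr// mul1r.
pose w := b * Num.sqrt (2 * ln (1 / delta)) * Num.sqrt V.
have w2 : w ^+ 2 = b ^+ 2 * (2 * ln (1 / delta)) * V.
  by rewrite !exprMn !sqr_sqrtr// ?mulr_ge0// ltW.
have w0 : 0 < w by rewrite !mulr_gt0 ?sqrtr_gt0// mulr_gt0.
have bV0 : 0 < b ^+ 2 * V by rewrite mulr_gt0// exprn_gt0.
(* Minimiser of [l ^+ 2 * (b ^+ 2 * V) / 2 - l * w]; the minimum is [- ln (1 / delta)]. *)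
pose l := w / (b ^+ 2 * V).
have lpos : 0 <= l by rewrite divr_ge0// ltW.
apply: le_trans (discrete_chernoff lpos HBad) _.
rewrite -[leRHS]lnK ?posrE// ler_expR.
have lw : l * w = 2 * ln (1 / delta).
  by rewrite /l mulrAC -expr2 w2; field; rewrite !gt_eqF.
have l2 : l ^+ 2 * (b ^+ 2 * V) / 2 = ln (1 / delta).
  by rewrite /l expr_div_n w2; field; rewrite !gt_eqF.
rewrite l2; have := ler_wpM2l lpos tge; rewrite -/w mulrDr lw.
by rewrite !ln_div ?posrE// ln1; lra.
Qed.

End discrete_concentration.

(** * Measurability and discretization *)

Section measurability.
Context {R : realType}.

Lemma measurable_forall d (T : measurableType d) (J : finType) (B : J -> set T) :
  (forall j, measurable (B j)) -> measurable [set x | forall j, B j x].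
Proof.
move=> mB; rewrite (_ : [set x | _] = \big[setI/setT]_j B j).
  by apply: bigsetI_measurable.
rewrite -bigcap_seq; apply/seteqP; split=> x /= Bx j; first by move=> _; exact: Bx.
by apply: Bx => /=; rewrite mem_index_enum.
Qed.

Lemma measurable_fun_gt d (T : measurableType d) (g : T -> R) :
  (forall r, measurable [set x | r < g x]) -> measurable_fun setT g.
Proof.
move=> mg; apply: (measurability _ (RGenOInfty.measurableE R)).
move=> _ [_ [r ->] <-]; rewrite setTI [X in measurable X](_ : _ = [set x | r < g x])//.
by apply/seteqP; split=> x /=; rewrite in_itv/= andbT.
Qed.

Lemma l1norm_ball h (x y : 'cV[R]_h) (e : R) :
  (forall i, `|x i 0 - y i 0| <= e) -> l1norm (x - y) <= h%:R * e.
Proof.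
move=> xy; apply: (@le_trans _ _ (\sum_(i < h) e)).
  by apply: ler_sum => i _; have := xy i; rewrite !mxE.
by rewrite sumr_const card_ord mulr_natl.
Qed.

Lemma lipschitz_measurable h (f : 'cV[R]_h -> R) (C : R) : 0 <= C ->
    (forall x y, `|f x - f y| <= C * l1norm (x - y)) ->
  measurable_fun setT (f : borelRn R h -> R).
Proof.
move=> C0 fC; apply: measurable_fun_gt => r.
apply: sub_sigma_algebra; rewrite /= openE => x /= rx.
pose e := (f x - r) / (C * h%:R + 1).
have D0 : 0 < C * h%:R + 1 by rewrite ltr_wpDl// mulr_ge0.
have e0 : 0 < e by rewrite divr_gt0// subr_gt0.
apply/nbhs_ballP; exists e => //= y [_ xy].
have := fC x y; have : l1norm (x - y) <= h%:R * e.
  by apply: l1norm_ball => i; exact: ltW (xy i 0).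
move=> /(ler_wpM2l C0) h1 /le_trans /(_ h1); rewrite ler_norml => /andP[_ h2].
have : C * (h%:R * e) + e = f x - r.
  by rewrite mulrA -[X in _ + X]mul1r -mulrDl mulrC divfK// gt_eqF.
by move: h2 => /=; lra.
Qed.

Lemma measurable_coord h (i : 'I_h) :
  measurable_fun setT (fun x : borelRn R h => (x : 'cV[R]_h) i 0).
Proof.
apply: (@lipschitz_measurable _ (fun x : 'cV[R]_h => x i 0) 1) => // x y.
rewrite mul1r (_ : x i 0 - y i 0 = (x - y) i 0); last by rewrite !mxE.
exact: le_trans (normr_le_l2norm _ _) (l2norm_le_l1 _).
Qed.

Lemma measurable_l2ball h (G : R) :
  measurable ([set x | l2norm x <= G] : set (borelRn R h)).
Proof.
have : measurable_fun setT (@l2norm R h : borelRn R h -> R).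
  apply: (@lipschitz_measurable _ _ 1) => // x y; rewrite mul1r.
  exact: le_trans (l2norm_sub _ _) (l2norm_le_l1 _).
move=> mf; have := measurable_fun_le measurableT mf (measurable_cst G).
by rewrite setTI.
Qed.

(** Needed for a supremum over an uncountable class. By the Lipschitz condition a superlevel set of
    [g] is a countable union of boxes with rational centres, and the preimage of a box constrains
    one real coordinate at a time. *)
Lemma measurable_fun_lipschitz_pi d (Omega : measurableType d) h (I : finType)
    (X : I -> Omega -> 'cV[R]_h) (g : (I -> 'cV[R]_h) -> R) (C : R) :
    (forall s, measurable_fun setT (X s : Omega -> borelRn R h)) -> 0 <= C ->
    (forall x y, `|g x - g y| <= C * \sum_s l1norm (x s - y s)) ->
  measurable_fun setT (fun w => g (fun s => X s w)).
Proof.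
move=> mX C0 gC; apply: measurable_fun_gt => r.
pose J : finType := (I * 'I_h)%type.
pose near (q : {ffun J -> rat}) (n : nat) : set (I -> 'cV[R]_h) :=
  [set x | forall j : J, `|x j.1 j.2 0 - ratr (q j)| <= n.+1%:R^-1].
pose E (qn : {ffun J -> rat} * nat) : set Omega :=
  if `[< near qn.1 qn.2 `<=` [set x | r < g x] >]
  then [set w | near qn.1 qn.2 (fun s => X s w)] else set0.
rewrite (_ : [set w | _] = \bigcup_qn E qn).
  apply: countable_bigcupT_measurable => [|[q n]]; first exact: countableP.
  rewrite /E; case: ifP => _ //=.
  apply: measurable_forall => -[s i] /=.
  have mc : measurable_fun setT (fun w => `|X s w i 0 - ratr (q (s, i))|).
    apply: measurableT_comp => //; apply: measurable_funB => //.
    exact: measurableT_comp (measurable_coord i) (mX s).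
  have := measurable_fun_le measurableT mc (measurable_cst (n.+1%:R^-1 : R)).
  by rewrite setTI.
apply/seteqP; split=> [w /= rg|w [[q n] _]]; last first.
  by rewrite /E/=; case: asboolP => //= H /H.
(* Two points of a box of radius [y] differ by at most [2 * y] in each of the [#|I| * h]
   coordinates; the 1 keeps [D] positive. *)
pose D := C * (#|I|%:R * (h%:R * 2)) + 1.
have D0 : 0 < D by rewrite ltr_wpDl// !mulr_ge0.
have e0 : 0 < (g (fun s => X s w) - r) / D by rewrite divr_gt0// subr_gt0.
have [n Hn] : exists n : nat, n.+1%:R^-1 < (g (fun s => X s w) - r) / D.
  have [n _ /(_ n (leqnn n))] := near_infty_natSinv_lt (PosNum e0).
  by exists n.
pose y : R := n.+1%:R^-1.
have y0 : 0 < y by rewrite invr_gt0.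
have /choice[q Hq] : forall j : J, exists q : rat, `|X j.1 w j.2 0 - ratr q| < y.
  move=> j; have : X j.1 w j.2 0 - y < X j.1 w j.2 0 + y by lra.
  move=> /rat_in_itvoo[q]; rewrite in_itv/= => /andP[q1 q2]; exists q.
  by rewrite ltr_norml; lra.
exists (finfun q, n) => //; rewrite /E/=.
have near1 : near (finfun q) n (fun s => X s w) by move=> j; rewrite ffunE; apply/ltW/Hq.
case: asboolP => // -[] x /= nx.
have xw s : l1norm (X s w - x s) <= h%:R * (2 * y).
  apply: l1norm_ball => i; have := nx (s, i); have := near1 (s, i); rewrite -/y /=.
  have := ler_normB (X s w i 0 - ratr (finfun q (s, i))) (x s i 0 - ratr (finfun q (s, i))).
  by rewrite opprB addrA subrK; lra.
have := gC (fun s => X s w) x.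
have : \sum_s l1norm (X s w - x s) <= #|I|%:R * (h%:R * (2 * y)).
  by apply: le_trans (ler_sum _ (fun s _ => xw s)) _; rewrite sumr_const -[leLHS]mulr_natl.
move=> /(ler_wpM2l C0) h1 /le_trans /(_ h1); rewrite ler_norml => /andP[_ h2].
move: Hn; rewrite -/y ltr_pdivlMr// /D; move: h2.
have -> : C * (#|I|%:R * (h%:R * (2 * y))) = y * (C * (#|I|%:R * (h%:R * 2))) by ring.
by lra.
Qed.

End measurability.

Section discretization.
Context {R : realType} {h : nat}.

(** A letter records, for each coordinate and each threshold of a grid of step [r], on which side
    the point lies. Representatives are taken inside the ball, where the oscillation and Rademacher
    bounds apply. *)
Lemma l2ball_discretization (G eta : R) : 0 < G -> 0 < eta ->
  exists (A : finType) (q : 'cV[R]_h -> A) (z : A -> 'cV[R]_h),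
  [/\ forall a, measurable (q @^-1` [set a] : set (borelRn R h)),
      forall a, l2norm (z a) <= G &
      forall x, l2norm x <= G -> l1norm (x - z (q x)) <= eta].
Proof.
move=> G0 eta0.
pose r := eta / h.+1%:R.
have r0 : 0 < r by rewrite divr_gt0.
pose K := (Num.truncn (2 * G / r)).+1.
pose A : finType := {ffun ('I_h * 'I_K) -> bool}.
pose q (x : 'cV[R]_h) : A := [ffun p : 'I_h * 'I_K => - G + r * p.2%:R <= x p.1 0].
(* Letters attained by no point of the ball get the default 0, which also lies in the ball. *)
pose z (a : A) := xget 0 [set x | l2norm x <= G /\ q x = a].
have zq x : l2norm x <= G -> l2norm (z (q x)) <= G /\ q (z (q x)) = q x.
  by move=> xG; rewrite /z; case: xgetP => [y -> //|/(_ x)[]].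
exists A, q, z; split=> [a|a|x xG].
- rewrite [X in measurable X](_ : _ = [set x : borelRn R h |
      forall p : 'I_h * 'I_K, (- G + r * p.2%:R <= (x : 'cV[R]_h) p.1 0) = a p]).
    apply: measurable_forall => -[i j] /=.
    have := measurable_fun_le measurableT (measurable_cst (- G + r * j%:R)) (measurable_coord i).
    rewrite setTI; case: (a (i, j)) => // /measurableC mB.
    rewrite [X in measurable X](_ : _ =
      ~` [set x : borelRn R h | - G + r * j%:R <= (x : 'cV[R]_h) i 0])//.
    by apply/seteqP; split=> x /=; [move=> ->|move=> /negP/negbTE].
  apply/seteqP; split=> x /= => [<- p|H]; first by rewrite ffunE.
  by apply/ffunP => p; rewrite ffunE.
- rewrite /z; case: xgetP => [y -> [] //|_].
  apply: le_trans (l2norm_le_l1 _) _; rewrite /l1norm big1 ?ltW// => i _.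
  by rewrite mxE normr0.
have [zG zqE] := zq x xG.
have sep (u v : 'cV[R]_h) i : l2norm u <= G -> l2norm v <= G -> q u = q v ->
    u i 0 - v i 0 <= r.
  move=> uG vG quv; rewrite leNgt; apply/negP => uv.
  have := le_trans (normr_le_l2norm u i) uG; have := le_trans (normr_le_l2norm v i) vG.
  rewrite !ler_norml => /andP[v1 v2] /andP[u1 u2].
  have t0 : 0 <= (u i 0 + G) / r by rewrite divr_ge0// ?ltW//; lra.
  have /andP[t1 t2] := truncn_itv t0.
  (* The last threshold not above [u i 0] is within [r] of it, hence above [v i 0], and the letters
     differ there. *)
  pose t := Num.truncn ((u i 0 + G) / r).
  have tK : (t < K)%N.
    rewrite ltnS; apply: le_truncn; rewrite ler_pM2r ?invr_gt0//; lra.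
  have /(congr1 (fun a : A => a (i, Ordinal tK))) := quv; rewrite !ffunE/=.
  move: t1 t2; rewrite -/t ler_pdivlMr// ltr_pdivrMr// -natr1 mulrDl mul1r => t1 t2.
  have -> : - G + r * t%:R <= u i 0 by lra.
  by move=> /esym; rewrite mulrC; lra.
apply: le_trans (l1norm_ball (e := r) _) _ => [i|].
  rewrite ler_norml; have := sep _ _ i xG zG (esym zqE); have := sep _ _ i zG xG zqE; lra.
by rewrite /r mulrCA ger_pMr// ler_pdivrMr// mul1r ler_nat.
Qed.

End discretization.

(** * Integrals against laws on the ball and empirical measures *)

Section integrals.
Context {R : realType} {h : nat}.

Lemma ae_l2ball (G : R) (mu : probability (borelRn R h) R) :
  bounded_support G mu -> {ae mu, forall x : borelRn R h, l2norm (x : 'cV[R]_h) <= G}.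
Proof.
move=> muG; exists (~` [set x : borelRn R h | l2norm (x : 'cV[R]_h) <= G]); split => //.
  by apply: measurableC; exact: measurable_l2ball.
rewrite probability_setC; last exact: measurable_l2ball.
by rewrite [X in (1 - X)%E]muG subee.
Qed.

Lemma integrable_lipschitz (G C : R) (mu : probability (borelRn R h) R)
    (f : 'cV[R]_h -> R) : bounded_support G mu -> 0 <= G -> 0 <= C ->
    (forall x y, `|f x - f y| <= C * l1norm (x - y)) ->
  mu.-integrable setT (EFin \o (f : borelRn R h -> R)).
Proof.
move=> muG G0 C0 fC; have mf := lipschitz_measurable C0 fC.
have M0 : 0 <= `|f 0| + C * (h%:R * G) by rewrite addr_ge0// !mulr_ge0.
apply/integrableP; split; first exact/measurable_EFinP.
apply: (@le_lt_trans _ _ ((`|f 0| + C * (h%:R * G))%:E * mu setT)%E).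
  apply: integral_le_bound => //; first exact/measurable_EFinP.
  move: (ae_l2ball muG); apply: filterS => x xG _; rewrite /= lee_fin.
  have : l1norm ((x : 'cV[R]_h) - 0) <= h%:R * G.
    apply: l1norm_ball => i; rewrite mxE subr0.
    exact: le_trans (normr_le_l2norm _ _) xG.
  move=> /(ler_wpM2l C0); have := fC x 0.
  have := ler_normD (f x - f 0) (f 0); rewrite subrK; lra.
by rewrite probability_setT mule1 ltry.
Qed.

(** The finite sum is the integral of the simple function [f (z (q x))], which is within [C * eta]
    of [f] on the ball, that is almost everywhere. *)
Lemma integral_discretization (G C eta : R) (mu : probability (borelRn R h) R)
    (f : 'cV[R]_h -> R) (A : finType) (q : 'cV[R]_h -> A) (z : A -> 'cV[R]_h) :
    bounded_support G mu -> 0 <= G -> 0 <= C -> 0 <= eta ->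
    (forall x y, `|f x - f y| <= C * l1norm (x - y)) ->
    (forall a, measurable (q @^-1` [set a] : set (borelRn R h))) ->
    (forall x, l2norm x <= G -> l1norm (x - z (q x)) <= eta) ->
  `|fine (\int[mu]_x (f x)%:E) -
    \sum_a fine (mu (q @^-1` [set a])) * f (z a)| <= C * eta.
Proof.
move=> muG G0 C0 eta0 fC mq qz.
have intf := integrable_lipschitz muG G0 C0 fC.
pose g (a : A) (x : borelRn R h) : \bar R := ((f (z a))%:E * (\1_(q @^-1` [set a]) x)%:E)%E.
have intg a : mu.-integrable setT (g a).
  apply: integrableZl => //; exact: integrable_indic.
have gE x : (\sum_a g a x)%E = (f (z (q x)))%:E.
  rewrite (bigD1 (q x))//= big1 ?adde0.
    by rewrite /g indicE mem_set// mule1.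
  move=> a aq; rewrite /g indicE memNset ?mule0// => /= qa.
  by move: aq; rewrite qa eqxx.
have intG : mu.-integrable setT (fun x => \sum_a g a x)%E.
  exact: integrable_sum.
have -> : \sum_a fine (mu (q @^-1` [set a])) * f (z a) =
    fine (\int[mu]_x (\sum_a g a x)%E).
  rewrite integral_sum// -sum_fine; last first.
    by move=> a _; exact: integrable_fin_num.
  apply: eq_bigr => a _; rewrite /g integralZl//; last exact: integrable_indic.
  rewrite integral_indic// setIT mulrC fineM//.
  by rewrite fin_num_measure//; exact: mq.
rewrite -fineB ?integrable_fin_num// -integralB//.
rewrite -lee_fin -[(`|_|%:E)]/(`|(fine _)%:E|%E) fineK; last first.
  by apply: integrable_fin_num => //; exact: integrableB.
apply: (@le_trans _ _ ((C * eta)%:E * mu setT)%E); last first.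
  by rewrite probability_setT mule1.
apply: le_trans (le_abse_integral _ _ _) _ => //.
  by apply: (measurable_int mu); exact: integrableB.
apply: integral_le_bound => //.
- by apply: (measurable_int mu); exact: integrableB.
- by rewrite lee_fin mulr_ge0.
move: (ae_l2ball muG); apply: filterS => x xG _.
rewrite /= gE -EFinB /= lee_fin; apply: le_trans (fC _ _) _.
by rewrite ler_wpM2l// qz.
Qed.

Lemma integral_empirical d (T : measurableType d) (n : nat) (x : 'I_n -> T)
    (f : T -> R) : measurable_fun setT f ->
  (\int[empirical R x]_y (f y)%:E)%E = (n%:R^-1 * \sum_i f (x i))%:E.
Proof.
move=> mf.
pose mx := fun j : nat =>
  oapp (fun i : 'I_n => (\d_(x i) : {measure set T -> \bar R})) mzero (insub j).
have E A : empirical R x A = mscale ((n%:R^-1)%:nng)%R (msum mx n) A.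
  rewrite /empirical /mscale/= /msum/=; congr (_ * _)%E.
  by apply: eq_bigr => i _; rewrite /mx valK.
have pos (g : T -> \bar R) : measurable_fun setT g -> (forall y, 0 <= g y)%E ->
    (\int[empirical R x]_y g y = (n%:R^-1)%:E * \sum_i g (x i))%E.
  move=> mg g0.
  rewrite (eq_measure_integral (mscale ((n%:R^-1)%:nng)%R (msum mx n))); last first.
    by move=> A _ _; exact: E.
  rewrite ge0_integral_mscale//= ge0_integral_measure_sum//; congr (_ * _)%E.
  apply: eq_bigr => i _; rewrite /mx valK/= integral_dirac// diracT mul1e//.
rewrite integralE pos//; last exact/measurable_funepos/measurable_EFinP.
rewrite pos//; last exact/measurable_funeneg/measurable_EFinP.
have -> : (\sum_i (fun y => (f y)%:E)^\+ (x i))%E = (\sum_i Num.max (f (x i)) 0)%:E.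
  by rewrite -sumEFin; apply: eq_bigr => i _; rewrite funeposE EFin_max.
have -> : (\sum_i (fun y => (f y)%:E)^\- (x i))%E = (\sum_i Num.max (- f (x i)) 0)%:E.
  by rewrite -sumEFin; apply: eq_bigr => i _; rewrite funenegE EFin_max.
rewrite -!EFinM -EFinB -mulrBr -sumrB; congr (_ * _)%:E; apply: eq_bigr => i _.
by rewrite !maxElt; case: ltP => f0; case: ltP => f1; lra.
Qed.

End integrals.

(** * Concentration of the neural net distance *)

Lemma measure_bigsetU_le d (T : measurableType d) (R : realType)
    (mu : {measure set T -> \bar R}) (J : finType) (Q : pred J) (B : J -> set T) :
  (forall j, measurable (B j)) ->
  (mu (\big[setU/set0]_(j | Q j) B j) <= \sum_(j | Q j) mu (B j))%E.
Proof.
move=> mB; elim: (index_enum J) => [|j r IH]; first by rewrite !big_nil measure0.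
rewrite !big_cons; case: ifP => // _.
apply: le_trans (measureU2 _ _ _) _ => //; first exact: bigsetU_measurable.
by rewrite leeD2l.
Qed.

Lemma sumr_ord_const (R : pzRingType) n (a : R) : \sum_(i < n) a = n%:R * a.
Proof. by rewrite sumr_const card_ord mulr_natl. Qed.

Section sup_norm.
Context {R : realType} {T : Type} (F : set T).
Hypothesis F0 : F !=set0.

(** The bounds [Bu] and [Bv] make both suprema genuine: the real [sup] of an unbounded set is a
    default value. *)
Lemma sup_norm_perturb (u v : T -> R) (t Bu Bv : R) :
    (forall f, F f -> `|u f| <= Bu) -> (forall f, F f -> `|v f| <= Bv) ->
    (forall f, F f -> `|u f - v f| <= t) ->
  `|sup [set `|u f| | f in F] - sup [set `|v f| | f in F]| <= t.
Proof.
have half (u' v' : T -> R) (B' : R) : (forall f, F f -> `|v' f| <= B') ->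
    (forall f, F f -> `|u' f - v' f| <= t) ->
    sup [set `|u' f| | f in F] <= sup [set `|v' f| | f in F] + t.
  move=> vB uv; apply: ge_sup; first by have [f Ff] := F0; exists `|u' f|, f.
  move=> _ [f Ff <-]; have : `|v' f| <= sup [set `|v' f| | f in F].
    by apply: ub_le_sup; [exists B' => _ [g Fg <-]; exact: vB|exists f].
  have := ler_normD (u' f - v' f) (v' f); have := uv f Ff; rewrite subrK; lra.
move=> uB vB uv; have h1 := half u v Bv vB uv.
have h2 : sup [set `|v f| | f in F] <= sup [set `|u f| | f in F] + t.
  by apply: half uB _ => f Ff; rewrite distrC; exact: uv.
by rewrite ler_norml; lra.
Qed.

End sup_norm.

Section nn_distance.
Context {R : realType} {h : nat} (F : set ('cV[R]_h -> R)).
Hypothesis F0 : F !=set0.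

Lemma nn_distanceE (mu nu : {measure set (borelRn R h) -> \bar R})
    (u v : ('cV[R]_h -> R) -> R) (B : R) :
    (forall f, F f -> (\int[mu]_x (f x)%:E = (u f)%:E)%E) ->
    (forall f, F f -> (\int[nu]_x (f x)%:E = (v f)%:E)%E) ->
    (forall f, F f -> `|u f - v f| <= B) ->
  nn_distance F mu nu = (sup [set `|u f - v f| | f in F])%:E.
Proof.
move=> uE vE uvB; rewrite -ereal_sup_EFin; last 2 first.
- by exists B => _ [f Ff <-]; exact: uvB.
- by have [f Ff] := F0; exists `|u f - v f|, f.
congr ereal_sup; apply/seteqP; split=> [_ [f Ff <-]|_ [_ [f Ff <-] <-]].
  by exists `|u f - v f|; [exists f|rewrite uE// vE// -EFinB].
by exists f => //; rewrite uE// vE// -EFinB.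
Qed.

End nn_distance.

Section concentration.
Context {R : realType} {h n m : nat} (F : set ('cV[R]_h -> R)) (G C b rho delta : R).
Context {mu nu : probability (borelRn R h) R}.
Context {disp : measure_display} {Omega : measurableType disp} {P : probability Omega R}.
Context {X : 'I_n -> {RV P >-> borelRn R h}} {Y : 'I_m -> {RV P >-> borelRn R h}}.
Hypotheses (F0 : F !=set0) (FN : forall f, F f -> F (fun x => - f x))
  (C_ge0 : 0 <= C) (FC : forall f x y, F f -> `|f x - f y| <= C * l1norm (x - y))
  (b_gt0 : 0 < b)
  (osc : forall f x y, F f -> l2norm x <= G -> l2norm y <= G -> `|f x - f y| <= b)
  (rho_ge0 : 0 <= rho) (Frad : rademacher_le F G rho) (G_gt0 : 0 < G)
  (n_gt0 : (0 < n)%N) (m_gt0 : (0 < m)%N)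
  (muG : bounded_support G mu) (nuG : bounded_support G nu)
  (X_law : forall i, has_law (X i) mu) (Y_law : forall j, has_law (Y j) nu)
  (XY_indep : mutually_independent (pool X Y))
  (delta_gt0 : 0 < delta) (delta_lt1 : delta < 1).

Let I : finType := ('I_n + 'I_m)%type.

Let Z : I -> {RV P >-> borelRn R h} := pool X Y.

Let law (s : I) : probability (borelRn R h) R :=
  match s with inl _ => mu | inr _ => nu end.

Let c (s : I) : R := match s with inl _ => n%:R^-1 | inr _ => - m%:R^-1 end.

Let expect (s : I) (f : 'cV[R]_h -> R) : R := fine (\int[law s]_x (f x)%:E).

Let n0 : 0 < n%:R :> R. Proof. by rewrite ltr0n. Qed.

Let m0 : 0 < m%:R :> R. Proof. by rewrite ltr0n. Qed.

Let law_G s : bounded_support G (law s). Proof. by case: s. Qed.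

Let Z_law s A : measurable A -> P (Z s @^-1` A) = law s A.
Proof. by case: s => i mA; [exact: (X_law i mA)|exact: (Y_law i mA)]. Qed.

Let sum_c (u : I -> R) :
  \sum_s c s * u s = n%:R^-1 * (\sum_i u (inl i)) - m%:R^-1 * (\sum_j u (inr j)).
Proof.
rewrite big_sumType/= !mulr_sumr; congr (_ + _).
by rewrite -sumrN; apply: eq_bigr => j _; rewrite mulNr.
Qed.

Let sum_c_cst (a a' : R) :
  \sum_(s : I) c s * (match s with inl _ => a | inr _ => a' end) = a - a'.
Proof.
by rewrite sum_c !sumr_ord_const !mulKf ?gt_eqF.
Qed.

Let V := \sum_s c s ^+ 2.

Let VE : V = n%:R^-1 + m%:R^-1.
Proof.
have -> : V = \sum_s c s * c s by apply: eq_bigr => s _; rewrite expr2.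
rewrite sum_c /= !sumr_ord_const; by field; rewrite !gt_eqF.
Qed.

Let V_gt0 : 0 < V.
Proof. by rewrite VE addr_gt0// invr_gt0. Qed.

Let sqrtV_le : Num.sqrt V <= (Num.sqrt n%:R)^-1 + (Num.sqrt m%:R)^-1.
Proof.
have a0 : 0 < (Num.sqrt n%:R)^-1 :> R by rewrite invr_gt0 sqrtr_gt0.
have b0 : 0 < (Num.sqrt m%:R)^-1 :> R by rewrite invr_gt0 sqrtr_gt0.
rewrite -[leRHS]gtr0_norm ?addr_gt0// -sqrtr_sqr ler_wsqrtr// VE sqrrD.
rewrite !exprVn !sqr_sqrtr ?ltW//; have := mulr_gt0 a0 b0; lra.
Qed.

Let abs_c s : `|c s| <= 1.
Proof.
by case: s => i /=; rewrite ?normrN ger0_norm ?invr_ge0// invf_le1// ler1n.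
Qed.

Let sum_abs_c : \sum_s `|c s| = 2.
Proof.
rewrite big_sumType/=.
under eq_bigr do rewrite ger0_norm ?invr_ge0//.
under [X in _ + X]eq_bigr do rewrite normrN ger0_norm ?invr_ge0//.
by rewrite !sumr_ord_const !mulfV ?gt_eqF.
Qed.

Let emp_dev (x : I -> 'cV[R]_h) (f : 'cV[R]_h -> R) : R := \sum_s c s * f (x s).

Let law_dev (f : 'cV[R]_h -> R) : R := \sum_s c s * expect s f.

Let law_devE f : law_dev f = fine (\int[mu]_x (f x)%:E) - fine (\int[nu]_x (f x)%:E).
Proof. by rewrite -sum_c_cst; apply: eq_bigr => -[i|j]. Qed.

Let emp_dev_lipschitz x y f : F f ->
  `|emp_dev x f - emp_dev y f| <= C * \sum_s l1norm (x s - y s).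
Proof.
move=> Ff; rewrite -sumrB mulr_sumr (le_trans (ler_norm_sum _ _ _))//.
apply: ler_sum => s _; rewrite -mulrBr normrM -[leRHS]mul1r.
by apply: ler_pM => //; exact: FC.
Qed.

Let emp_dev_bound x f : F f -> `|emp_dev x f| <= C * \sum_s l1norm (x s - 0).
Proof.
move=> Ff; have -> : emp_dev x f = emp_dev x f - emp_dev (fun=> 0) f.
  have -> : emp_dev (fun=> 0) f = f 0 - f 0.
    by rewrite -sum_c_cst; apply: eq_bigr => -[i|j].
  by rewrite subrr subr0.
exact: emp_dev_lipschitz.
Qed.

(** The discretization estimate for a one-letter alphabet with representative 0. *)
Let expect_near0 s f : F f -> `|expect s f - f 0| <= C * (h%:R * G).
Proof.
move=> Ff.
have := @integral_discretization R h G C (h%:R * G) (law s) f unit (fun=> tt) (fun=> 0)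
  (law_G s) (ltW G_gt0) C_ge0 (mulr_ge0 (ler0n _ _) (ltW G_gt0)) (fun x y => FC x y Ff).
rewrite (bigD1 tt)//= big1 ?addr0; last by case.
have -> : (fun=> tt) @^-1` [set tt] = [set: borelRn R h] by apply/seteqP; split.
rewrite probability_setT mul1r; apply=> [[]|x xG].
  by have -> : (fun=> tt) @^-1` [set tt] = [set: borelRn R h] by apply/seteqP; split.
apply: l1norm_ball => i; rewrite mxE subr0; exact: le_trans (normr_le_l2norm _ _) xG.
Qed.

Let law_dev_bound f : F f -> `|law_dev f| <= 2 * (C * (h%:R * G)).
Proof.
(* The weights [c] sum to 0, so the constant [f 0] can be subtracted; it has no bound uniform in [F]
   among the hypotheses. *)
move=> Ff; have -> : law_dev f = \sum_s c s * (expect s f - f 0).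
  have -> : \sum_s c s * (expect s f - f 0) =
      law_dev f - \sum_s c s * (match s with inl _ => f 0 | inr _ => f 0 end).
    by rewrite -sumrB; apply: eq_bigr => -[i|j] _; rewrite mulrBr.
  by rewrite sum_c_cst subrr subr0.
rewrite (le_trans (ler_norm_sum _ _ _))// -sum_abs_c mulr_suml.
by apply: ler_sum => s _; rewrite normrM ler_wpM2l// expect_near0.
Qed.

Let law_distance : nn_distance F mu nu = (sup [set `|law_dev f| | f in F])%:E.
Proof.
have intf s f : F f -> (\int[law s]_x (f x)%:E = (expect s f)%:E)%E.
  move=> Ff; rewrite fineK// ; apply: integrable_fin_num => //.
  exact: (integrable_lipschitz (law_G s) (ltW G_gt0) C_ge0 (fun x y => FC x y Ff)).
rewrite (@nn_distanceE _ _ _ F0 mu nu (fun f => fine (\int[mu]_x (f x)%:E))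
    (fun f => fine (\int[nu]_x (f x)%:E)) (2 * (C * (h%:R * G)))).
- by congr (sup _)%:E; apply: eq_imagel => f Ff; rewrite law_devE.
- by move=> f Ff; exact: (intf (inl (Ordinal n_gt0))).
- by move=> f Ff; exact: (intf (inr (Ordinal m_gt0))).
- by move=> f Ff; rewrite -law_devE law_dev_bound.
Qed.

Let emp_distance w :
  nn_distance F (empirical R (fun i => X i w)) (empirical R (fun j => Y j w)) =
  (sup [set `|emp_dev (fun s => Z s w) f| | f in F])%:E.
Proof.
have mf f : F f -> measurable_fun setT (f : borelRn R h -> R).
  by move=> Ff; apply: lipschitz_measurable C_ge0 _ => x y; exact: FC.
have E f : n%:R^-1 * (\sum_i f (X i w)) - m%:R^-1 * (\sum_j f (Y j w)) =
    emp_dev (fun s => Z s w) f by rewrite /emp_dev sum_c.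
rewrite (@nn_distanceE _ _ _ F0 _ _ (fun f => n%:R^-1 * (\sum_i f (X i w)))
    (fun f => m%:R^-1 * (\sum_j f (Y j w))) (C * \sum_s l1norm ((Z s w : 'cV[R]_h) - 0))).
- by congr (sup _)%:E; apply: eq_imagel => f Ff; rewrite E.
- by move=> f Ff; rewrite integral_empirical//; exact: mf.
- by move=> f Ff; rewrite integral_empirical//; exact: mf.
- by move=> f Ff; rewrite E emp_dev_bound.
Qed.

Let D w : R := sup [set `|law_dev f| | f in F] -
  sup [set `|emp_dev (fun s => Z s w) f| | f in F].

Let measurable_D : measurable_fun setT D.
Proof.
apply: (@measurable_fun_lipschitz_pi R _ Omega h I (fun s => Z s)
  (fun x => sup [set `|law_dev f| | f in F] - sup [set `|emp_dev x f| | f in F]) C) => //.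
move=> x y; set a := sup _; set ax := sup _; set ay := sup _.
have -> : a - ax - (a - ay) = - (ax - ay) by lra.
rewrite normrN; apply: sup_norm_perturb => // [f Ff|f Ff|f Ff]; first exact: (emp_dev_bound _ Ff).
  exact: (emp_dev_bound _ Ff).
exact: emp_dev_lipschitz.
Qed.

(** Two suprema differ by at most the largest difference of their terms, and closure under negation
    turns its lower side into an upper one. *)
Let deviation_bound w t : t < `|D w| ->
  exists2 f, F f & t < \sum_s c s * (f (Z s w) - expect s f).
Proof.
move=> tD; apply: contrapT => nH.
have H f : F f -> \sum_s c s * (f (Z s w) - expect s f) <= t.
  by move=> Ff; rewrite leNgt; apply/negP => tf; apply: nH; exists f.
have E f : \sum_s c s * (f (Z s w) - expect s f) = emp_dev (fun s => Z s w) f - law_dev f.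
  by rewrite -sumrB; apply: eq_bigr => s _; rewrite mulrBr.
have ENf f : F f -> \sum_s c s * (- f (Z s w) - expect s (fun x => - f x)) =
    law_dev f - emp_dev (fun s => Z s w) f.
  move=> Ff; rewrite -sumrB; apply: eq_bigr => s _.
  have -> : expect s (fun x => - f x) = - expect s f.
    rewrite /expect -fineN; congr fine.
    under eq_integral do rewrite EFinN.
    rewrite integralN//; apply: integrable_add_def => //.
    exact: (integrable_lipschitz (law_G s) (ltW G_gt0) C_ge0 (fun x y => FC x y Ff)).
  by rewrite opprK mulrDr mulrN addrC.
move: tD; rewrite ltNge => /negP; apply.
apply: sup_norm_perturb => // [f Ff|f Ff|f Ff].
- exact: law_dev_bound.
- exact: emp_dev_bound.
rewrite ler_norml; have := H f Ff; have := H _ (FN Ff); rewrite E ENf//; lra.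
Qed.

Lemma nn_distance_concentration (t : R) :
    (2 * rho + b * Num.sqrt (2 * ln (1 / delta))) *
      ((Num.sqrt n%:R)^-1 + (Num.sqrt m%:R)^-1) < t ->
  holds_with_prob_ge P (1 - delta)
    [set w | (`| nn_distance F mu nu -
        nn_distance F (empirical R (fun i => X i w)) (empirical R (fun j => Y j w))|
       <= t%:E)%E].
Proof.
move=> tgt.
have -> : [set w | (`| nn_distance F mu nu -
      nn_distance F (empirical R (fun i => X i w)) (empirical R (fun j => Y j w))|
       <= t%:E)%E] = [set w | `|D w| <= t].
  by apply/seteqP; split=> w /=; rewrite law_distance emp_distance -EFinB /= lee_fin.
have mgood : measurable [set w | `|D w| <= t].
  have mD : measurable_fun setT (fun w => `|D w|) by exact: measurableT_comp measurable_D.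
  have := measurable_fun_le measurableT mD (measurable_cst t).
  by rewrite setTI.
split=> //.
pose t0 := 2 * (rho * Num.sqrt V) + b * Num.sqrt (2 * ln (1 / delta)) * Num.sqrt V.
have t0t : t0 < t.
  apply: le_lt_trans tgt; rewrite /t0 mulrA -mulrDl ler_wpM2l//.
  by rewrite addr_ge0 ?mulr_ge0 ?sqrtr_ge0// ltW.
(* Rounding perturbs both a sample value and its expectation by [C * eta], and the weights [|c s|]
   sum to 2, so the total error [4 * (C * eta)] fits into the slack; the 1 keeps the denominator
   positive. *)
pose eta := (t - t0) / (4 * C + 1).
have C4 : 0 < 4 * C + 1 by rewrite ltr_wpDl// mulr_ge0.
have eta0 : 0 < eta by rewrite divr_gt0// subr_gt0.
have etaE : 4 * (C * eta) <= t - t0.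
  have : (4 * C + 1) * eta = t - t0 by rewrite /eta mulrC divfK// gt_eqF.
  by move: eta0; lra.
have [A [q [z [mq zG qz]]]] := @l2ball_discretization R h G eta G_gt0 eta0.
pose p (s : I) (a : A) : R := fine (law s (q @^-1` [set a])).
have p0 s a : 0 <= p s a by exact: fine_ge0.
(* The discretization estimate for the constant 1, whose Lipschitz constant is 0, so there is no
   error. *)
have p1 s : \sum_a p s a = 1.
  have I1 : (\int[law s]_x 1%:E = 1%:E)%E by rewrite integral_cst// mul1e; exact: probability_setT.
  have cst1 (x y : 'cV[R]_h) : `|1 - 1| <= 0 * l1norm (x - y) :> R.
    by rewrite subrr normr0 mul0r.
  have := integral_discretization (law_G s) (ltW G_gt0) (lexx 0) (ltW eta0) cst1 mq qz.
  rewrite I1 mul0r normr_le0 subr_eq0 => /eqP /= ->.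
  by apply: eq_bigr => a _; rewrite mulr1.
pose Bad (a : {ffun I -> A}) : bool := `[< exists2 f, F f &
  t0 <= \sum_s c s * (f (z (a s)) - \sum_b p s b * f (z b)) >].
have sumBad : \sum_(a | Bad a) weight p a <= delta.
  apply: (discrete_concentration p0 p1 F0 zG osc Frad b_gt0 V_gt0 delta_gt0 delta_lt1 (lexx _)).
  by move=> a /asboolP.
pose cell (a : {ffun I -> A}) : set Omega := [set w | forall s, q (Z s w) = a s].
have mcell a : measurable (cell a).
  apply: measurable_forall => s.
  by rewrite -[X in measurable X]setTI; exact: (measurable_funP (Z s)) (mq (a s)).
(* Independence identifies the law of the rounded samples with the product weights of the finite
   alphabet. *)
have Pcell a : P (cell a) = (weight p a)%:E.
  have := XY_indep (fun s => mq (a s)).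
  rewrite /weight -prodEFin => ->; apply: eq_bigr => s _.
  rewrite -/Z (Z_law s (mq (a s))).
  by rewrite fineK// fin_num_measure//; exact: mq.
pose ball : set Omega := [set w | forall s, l2norm (Z s w : 'cV[R]_h) <= G].
have mball : measurable ball.
  apply: measurable_forall => s; rewrite -[X in measurable X]setTI.
  exact: (measurable_funP (Z s)) (@measurable_l2ball R h G).
have Pball : P ball = 1%E.
  have := XY_indep (fun s => @measurable_l2ball R h G).
  rewrite -/ball => ->; apply: big1 => s _.
  by rewrite -/Z (Z_law s (@measurable_l2ball R h G)); exact: law_G.
(* Rounding is accurate only for samples in the ball; the complement of [ball] is a null event and
   is split off. *)
have bad_sub : ~` [set w | `|D w| <= t] `<=`
    ~` ball `|` \big[setU/set0]_(a | Bad a) cell a.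
  move=> w /= /negP; rewrite -ltNge => /deviation_bound[f Ff tf].
  have [wball|] := pselect (ball w); last by left.
  right; pose a : {ffun I -> A} := [ffun s => q (Z s w)].
  have Ba : Bad a.
    apply/asboolP; exists f => //.
    have close s : `|c s * (f (Z s w) - expect s f) -
        c s * (f (z (a s)) - \sum_b p s b * f (z b))| <= `|c s| * (2 * (C * eta)).
      rewrite -mulrBr normrM ler_wpM2l//.
      have h1 : `|f (Z s w) - f (z (a s))| <= C * eta.
        rewrite ffunE; apply: le_trans (FC _ _ Ff) _; rewrite ler_wpM2l//.
        exact/qz/wball.
      have h2 : `|expect s f - \sum_b p s b * f (z b)| <= C * eta.
        exact: (integral_discretization (law_G s) (ltW G_gt0) C_ge0 (ltW eta0)
                  (fun x y => FC x y Ff) mq qz).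
      rewrite opprB addrACA [X in _ + X]addrC addrACA.
      by move: h1 h2; rewrite !ler_norml; lra.
    have h1 : \sum_s `|c s * (f (Z s w) - expect s f) -
        c s * (f (z (a s)) - \sum_b p s b * f (z b))| <= 2 * (2 * (C * eta)).
      by rewrite -[X in _ <= X * _]sum_abs_c mulr_suml; apply: ler_sum.
    have := le_trans (ler_norm_sum _ _ _) h1; rewrite sumrB ler_norml => /andP[_ h2].
    by move: etaE tf h2; lra.
  rewrite (bigD1 a)//=; left => s; by rewrite ffunE.
have mU : measurable (\big[setU/set0]_(a | Bad a) cell a).
  exact: bigsetU_measurable.
have bad_le : (P (~` [set w | (`|D w| <= t)%R]) <= delta%:E)%E.
  apply: (@le_trans _ _ (P (~` ball) + P (\big[setU/set0]_(a | Bad a) cell a))%E).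
    apply: le_trans (measureU2 _ _ _) => //; last exact: measurableC.
    apply: le_measure => //; rewrite inE; first exact: measurableC.
    by apply: measurableU => //; exact: measurableC.
  rewrite probability_setC// Pball subee// add0e.
  apply: le_trans (measure_bigsetU_le _ _ mcell) _.
  rewrite (eq_bigr (fun a => (weight p a)%:E)); last by move=> a _; exact: Pcell.
  by rewrite sumEFin lee_fin.
have := probability_setC P (measurableC mgood); rewrite setCK => ->.
by rewrite EFinB leeB.
Qed.

End concentration.

(** * Nonempty classes and the final constants *)

Lemma network_class_l2_neq0 (R : realType) (k : nat -> nat) (d : nat)
    (sigma : nat -> R -> R) (M : nat -> R) :
    (0 < d)%N -> (forall i, (i < d)%N -> 0 < M i) ->
  network_class sigma (params_F (k := k) (d := d) M) !=set0.
Proof.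
move=> d0 M0; eexists; exists ((fun=> 0), 0); last by reflexivity.
have zero n : l2norm (0 : 'cV[R]_n) = 0.
  by rewrite /l2norm big1 ?sqrtr0// => i _; rewrite mxE expr0n.
split=> [i id /=|/=]; last by rewrite zero ltW// M0// prednK.
rewrite /frobenius_norm big1 ?sqrtr0; first by rewrite ltW// M0// (leq_trans id)// leq_pred.
by move=> j _; rewrite big1// => j' _; rewrite mxE expr0n.
Qed.

Lemma network_class_linf_neq0 (R : realType) (k : nat -> nat) (d : nat)
    (sigma : nat -> R -> R) (M : nat -> R) :
    (0 < d)%N -> (forall i, (i < d)%N -> 0 < M i) ->
  network_class sigma (params_1_inf (k := k) (d := d) M) !=set0.
Proof.
move=> d0 M0; eexists; exists ((fun=> 0), 0); last by reflexivity.
split=> [i id /=|/=].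
  apply/bigmax_leP; split=> [|j _]; first by rewrite ltW// M0// (leq_trans id)// leq_pred.
  by rewrite big1 ?ltW ?M0 ?(leq_trans id) ?leq_pred// => j' _; rewrite mxE normr0.
by rewrite /l1norm big1 ?ltW ?M0 ?prednK// => i _; rewrite mxE normr0.
Qed.

Theorem corollary4 (R : realType) (d : nat) (k : nat -> nat) (n m : nat)
    (sigma : nat -> R -> R) (MF M1inf : nat -> R) (GammaB delta : R)
    (mu nu : probability (borelRn R (k 0%N)) R)
    (disp : measure_display) (Omega : measurableType disp)
    (P : probability Omega R)
    (X : 'I_n -> {RV P >-> borelRn R (k 0%N)})
    (Y : 'I_m -> {RV P >-> borelRn R (k 0%N)})
    (d_ge2 : (2 <= d)%N)
    (k_gt0 : forall i, (i < d)%N -> (0 < k i)%N)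
    (n_gt0 : (0 < n)%N) (m_gt0 : (0 < m)%N)
    (MF_gt0 : forall i, (i < d)%N -> 0 < MF i)
    (M1inf_gt0 : forall i, (i < d)%N -> 0 < M1inf i)
    (GammaB_gt0 : 0 < GammaB)
    (sigma_relu : forall i, (i < d.-1)%N -> sigma i = relu)
    (mu_PB : bounded_support GammaB mu) (nu_PB : bounded_support GammaB nu)
    (X_law : forall i, has_law (X i) mu) (Y_law : forall j, has_law (Y j) nu)
    (XY_indep : mutually_independent (pool X Y))
    (delta_gt0 : 0 < delta) (delta_lt1 : delta < 1) :
  let mu_hat w := empirical R (fun i => X i w) in
  let nu_hat w := empirical R (fun j => Y j w) in
  let h := k 0%N in
  (let F := network_class sigma (params_F (k := k) (d := d) MF) in
   holds_with_prob_ge P (1 - delta)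
     [set w | (`| nn_distance F mu nu - nn_distance F (mu_hat w) (nu_hat w) |
       <= (Num.sqrt 2 * GammaB * (\prod_(i < d) MF i)
           * (2 * Num.sqrt (d%:R * ln 2) + Num.sqrt (ln (1 / delta))
              + Num.sqrt 2)
           * ((Num.sqrt n%:R)^-1 + (Num.sqrt m%:R)^-1))%:E)%E])
  /\
  (let F := network_class sigma (params_1_inf (k := k) (d := d) M1inf) in
   holds_with_prob_ge P (1 - delta)
     [set w | (`| nn_distance F mu nu - nn_distance F (mu_hat w) (nu_hat w) |
       <= (GammaB * (\prod_(i < d) M1inf i)
           * (4 * Num.sqrt (d%:R + 1 + ln h%:R)
              + Num.sqrt (2 * ln (1 / delta)))
           * ((Num.sqrt n%:R)^-1 + (Num.sqrt m%:R)^-1))%:E)%E]).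
Proof.
move=> mu_hat nu_hat h.
have d0 : (0 < d)%N by exact: ltnW.
pose S : R := (Num.sqrt n%:R)^-1 + (Num.sqrt m%:R)^-1.
have S0 : 0 < S by rewrite addr_gt0// invr_gt0 sqrtr_gt0 ltr0n.
have ln20 : 0 < ln (2 : R) by rewrite ln_gt0// ltr1n.
split=> F.
  pose L := \prod_(i < d) MF i.
  have L0 : 0 < L by apply: prodr_gt0 => i _; exact: MF_gt0.
  have b0 : 0 < L * GammaB by rewrite mulr_gt0.
  apply: (nn_distance_concentration (F := F) (G := GammaB) (C := L) (b := L * GammaB)
    (rho := L * GammaB * (Num.sqrt (2 * (d.-1%:R * ln 2)) + 1))) => //.
  - exact: network_class_l2_neq0.
  - by move=> f; exact: (@network_opp _ l2_norms).
  - exact: ltW.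
  - by move=> f x y; exact: (@network_lipschitz _ l2_norms _ _ _ _ d_ge2 MF_gt0 sigma_relu).
  - move=> f x y Ff xG yG.
    exact: (@network_oscillation _ l2_norms _ _ _ _ d_ge2 MF_gt0 sigma_relu _ _ _ _ Ff (ltW GammaB_gt0)).
  - by rewrite mulr_ge0 ?addr_ge0 ?sqrtr_ge0// ltW.
  - exact: rademacher_l2.
  rewrite -/L -/S ltr_pM2r// [Num.sqrt (2 * ln _)]sqrtrM// [Num.sqrt (2 * (_ * _))]sqrtrM//.
  (* The slack spent on rounding in part (I): peeling yields [d.-1] where the claim has [d]. *)
  have lt_d : Num.sqrt (d.-1%:R * ln 2) < Num.sqrt (d%:R * ln 2 : R).
    by rewrite ltr_sqrt ?mulr_gt0 ?ltr0n// ltr_pM2r// ltr_nat prednK.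
  have s2 : 0 < Num.sqrt (2 : R) by rewrite sqrtr_gt0.
  have s22 : Num.sqrt (2 : R) * Num.sqrt 2 = 2 by rewrite -expr2 sqr_sqrtr.
  have -> : Num.sqrt 2 * GammaB * L *
      (2 * Num.sqrt (d%:R * ln 2) + Num.sqrt (ln (1 / delta)) + Num.sqrt 2) =
      (L * GammaB) * (2 * (Num.sqrt 2 * Num.sqrt (d%:R * ln 2)) +
        Num.sqrt 2 * Num.sqrt (ln (1 / delta)) + Num.sqrt 2 * Num.sqrt 2) by ring.
  rewrite s22 mulrCA -mulrDr ltr_pM2l//.
  by have := lt_d; rewrite -(ltr_pM2l s2); lra.
pose L := \prod_(i < d) M1inf i.
have L0 : 0 < L by apply: prodr_gt0 => i _; exact: M1inf_gt0.
have b0 : 0 < L * GammaB by rewrite mulr_gt0.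
have h0 : (0 < k 0)%N by exact: k_gt0.
apply: (nn_distance_concentration (F := F) (G := GammaB) (C := L) (b := L * GammaB)
  (rho := L * GammaB * Num.sqrt (2 * (d%:R * ln 2 + ln (k 0)%:R)))) => //.
- exact: network_class_linf_neq0.
- by move=> f; exact: (@network_opp _ linf_norms).
- exact: ltW.
- by move=> f x y; exact: (@network_lipschitz _ linf_norms _ _ _ _ d_ge2 M1inf_gt0 sigma_relu).
- move=> f x y Ff xG yG.
  exact: (@network_oscillation _ linf_norms _ _ _ _ d_ge2 M1inf_gt0 sigma_relu _ _ _ _ Ff (ltW GammaB_gt0)).
- by rewrite mulr_ge0 ?sqrtr_ge0// ltW.
- exact: rademacher_linf.
rewrite -/L -/S -/h ltr_pM2r// mulrCA -mulrDr (mulrC GammaB) ltr_pM2l// ltrD2r.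
have lnh : 0 <= ln (h%:R : R) by rewrite ln_ge0// ler1n.
(* The slack in part (II): with [ln 2 <= 1], the quantity [2 * (d * ln 2 + ln h)] is below
   [4 * (d + 1 + ln h)]. *)
have ln21 : ln (2 : R) <= 1 by rewrite (_ : 2 = 1 + 1)// le_ln1Dx// ltrN10.
have dR : 0 < d%:R :> R by rewrite ltr0n.
have -> : 4 * Num.sqrt (d%:R + 1 + ln (h%:R : R)) =
    2 * Num.sqrt (2 ^+ 2 * (d%:R + 1 + ln h%:R)).
  by rewrite sqrtrM ?sqr_ge0// sqrtr_sqr ger0_norm//; lra.
rewrite ltr_pM2l// ltr_sqrt; nra.
Qed.
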